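(* Finitely generated free-by-cyclic groups are good.
   Context: A group is free-by-cyclic if it has a normal free subgroup (possibly of infinite rank) with cyclic quotient. A group $G$ is good (in the sense of Serre) if for every prime $p$, every $n\ge0$ and every finite $p$-primary $G$-module $M$, the homomorphism $H^n(\widehat{G},M)\to H^n(G,M)$ induced by the natural homomorphism $G\to\widehat{G}$ to the profinite completion is an isomorphism. *)

(* Defs.v *)
From HB Require Import structures.
From mathcomp Require Import all_boot all_algebra ring_quotient zify.
From mathcomp Require Import mathcomp_extra boolp classical_sets functions.
From mathcomp Require Import cardinality topology function_spaces.

Set Implicit Arguments.
Unset Strict Implicit.
Unset Printing Implicit Defensive.
Import GRing.Theory.
Local Open Scope classical_set_scope.
Local Open Scope quotient_scope.
Local Open Scope group_scope.

Section Subgroups.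
Variable G : groupType.
Implicit Types (F H N X : set G).

Definition subgroup H :=
  [/\ H 1, forall x y, H x -> H y -> H (x * y) & forall x, H x -> H x^-1].

Definition normal_subgroup N :=
  subgroup N /\ forall x g, N x -> N (x ^ g).

Definition lcoset N (g : G) : set G := [set g * x | x in N].

Definition finite_index N := finite_set (range (lcoset N)).

Definition finitely_generated :=
  exists s : seq G, forall H, subgroup H -> [set` s] `<=` H -> H = setT.

(* phi : F -> K is given by any function on G; only its values on F matter. *)
Definition morphism_on F (K : groupType) (phi : G -> K) :=
  forall x y, F x -> F y -> phi (x * y) = phi x * phi y.

(* The universal property of a free group F with basis X. *)
Definition free_basis F X :=
  X `<=` F /\
  forall (K : groupType) (f : G -> K),
    (exists phi : G -> K, morphism_on F phi /\ forall x, X x -> phi x = f x) /\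
    (forall phi psi : G -> K, morphism_on F phi -> morphism_on F psi ->
       (forall x, X x -> phi x = f x) -> (forall x, X x -> psi x = f x) ->
       forall x, F x -> phi x = psi x).

Definition free_subgroup F := subgroup F /\ exists X, free_basis F X.

(* G / N is generated by the coset of some t; finite quotients are allowed. *)
Definition cyclic_quotient N :=
  exists t, forall g, exists k : nat,
    lcoset N g = lcoset N (t ^+ k) \/ lcoset N g = lcoset N (t ^- k).

Definition free_by_cyclic :=
  exists F, [/\ normal_subgroup F, free_subgroup F & cyclic_quotient F].

Lemma lcosetP N g h : subgroup N -> lcoset N g = lcoset N h <-> N (g^-1 * h).
Proof.
move=> [N1 NM NV]; split=> [e|Ngh].
  have : lcoset N g h by rewrite e; exists 1 => //; rewrite mulg1.
  by move=> [x Nx <-]; rewrite mulKg.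
apply/seteqP; split=> _ [x Nx <-].
  exists ((g^-1 * h)^-1 * x); first by apply: NM => //; apply: NV.
  by rewrite invgM invgK !mulgA mulgV mul1g.
by exists (g^-1 * h * x); [exact: NM|rewrite !mulgA mulgV mul1g].
Qed.

Lemma lcoset_mul N g h : normal_subgroup N ->
  [set x * y | x in lcoset N g & y in lcoset N h] = lcoset N (g * h).
Proof.
move=> [[N1 NM NV] NJ]; apply/seteqP; split=> z.
  move=> [_ [x Nx <-]] [_ [y Ny <-]] <-; exists (x ^ h * y).
    by apply: NM => //; exact: NJ.
  by rewrite conjgE !mulgA mulgK.
move=> [x Nx <-]; exists g; first by exists 1 => //; rewrite mulg1.
by exists (h * x); [exists x|rewrite mulgA].
Qed.

Lemma lcoset_inv N g : normal_subgroup N ->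
  [set x^-1 | x in lcoset N g] = lcoset N g^-1.
Proof.
move=> [[N1 NM NV] NJ]; apply/seteqP; split=> z.
  move=> [_ [x Nx <-]] <-; exists (x^-1 ^ g^-1); first exact/NJ/NV.
  by rewrite conjgE invgK invgM !mulgA mulVg mul1g.
move=> [x Nx <-]; exists (g * (x ^ g)^-1).
  by exists (x ^ g)^-1 => //; exact/NV/NJ.
by rewrite invgM invgK conjgE !mulgA mulgK.
Qed.

End Subgroups.

HB.mixin Record isTopGroup K of Group K & Topological K := {
  mulg_continuous : continuous (fun xy : K * K => xy.1 * xy.2);
  invg_continuous : continuous (fun x : K => x^-1)
}.

#[short(type="topGroupType")]
HB.structure Definition TopGroup := {K of isTopGroup K & Group K & Topological K}.

Lemma continuous_discrete (X : topologicalType) (Y : choiceType)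
    (f : X -> discrete_topology Y) :
  continuous f <-> forall x, \forall y \near x, f y = f x.
Proof.
split=> cf x; first exact: (cf x _ (discrete_set1 (f x))).
by have [_] := @discrete_cvg (discrete_topology Y) (f @ x) (f x) _; apply; exact: cf.
Qed.

Lemma continuous_prod (X : topologicalType) (I : Type) (T : I -> topologicalType)
    (f : X -> prod_topology T) :
  (forall i, continuous (fun x => f x i)) -> continuous f.
Proof.
move=> cf x; apply/cvg_sup => i A; case=> [B [[C oC <-] /= Cx] sBA].
have nC : nbhs x [set y | C (f y i)] := cf i x C (open_nbhs_nbhs (conj oC Cx)).
by apply: (filterS _ nC) => y Cy; exact: sBA.
Qed.

Section DiscreteGroup.
Variable G : groupType.

HB.instance Definition _ := Group.copy (discrete_topology G) G.

Lemma discrete_mul_continuous :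
  continuous (fun xy : discrete_topology G * discrete_topology G => xy.1 * xy.2).
Proof.
apply/continuous_discrete => -[x y]; exists ([set x], [set y]) => /=.
  by split; exact: (@discrete_set1 (discrete_topology G)).
by move=> [u v] /= [-> ->].
Qed.

Lemma discrete_inv_continuous : continuous (fun x : discrete_topology G => x^-1).
Proof.
apply/continuous_discrete => x.
near=> y; have -> // : y = x.
by near: y; exact: (@discrete_set1 (discrete_topology G)).
Unshelve. all: by end_near.
Qed.

HB.instance Definition _ :=
  isTopGroup.Build (discrete_topology G) discrete_mul_continuous discrete_inv_continuous.

End DiscreteGroup.

Record finNormal (G : groupType) := FinNormal {
  finNormal_set :> set G;
  finNormal_normal : normal_subgroup finNormal_set;
  finNormal_index : finite_index finNormal_set
}.

HB.instance Definition _ (G : groupType) := gen_eqMixin (finNormal G).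

(* The inverse limit of the G / N, for N normal of finite index. An element of *)
(* G / N is a coset of N, and G / N -> G / N' sends a coset to the coset of N' *)
(* that contains it. *)
Definition compatible (G : groupType) (x : finNormal G -> set G) :=
  (forall N : finNormal G, exists g, x N = lcoset N g) /\
  (forall N N' : finNormal G, N `<=` N' -> x N `<=` x N').

Record completion (G : groupType) := Completion {
  completion_val :> finNormal G -> set G;
  completion_compatible : compatible completion_val
}.

HB.instance Definition _ (G : groupType) := gen_eqMixin (completion G).
HB.instance Definition _ (G : groupType) := gen_choiceMixin (completion G).

Section Completion.
Variable G : groupType.
Local Notation Gh := (completion G).
Implicit Types (x y z : Gh) (N : finNormal G).

Lemma completionP x y : (forall N, x N = y N) -> x = y.
Proof.
case: x y => [x xP] [y yP] /= xy; have e : x = y by exact/funext.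
by case: _ / e yP xy => yP _; congr Completion; exact: Prop_irrelevance.
Qed.

Lemma completion_coset x N : exists g, x N = lcoset N g.
Proof. by have [+ _] := completion_compatible x; apply. Qed.

Lemma completion_sub x N N' : N `<=` N' -> x N `<=` x N'.
Proof. by have [_] := completion_compatible x; apply. Qed.

Lemma compatible_one : compatible (fun N : finNormal G => lcoset N 1).
Proof.
by split=> [N|N N' sNN' _ [g Ng <-]]; [exists 1|exists g => //; exact: sNN'].
Qed.

Lemma compatible_mul x y :
  compatible (fun N => [set g * h | g in x N & h in y N]).
Proof.
split=> [N|N N' sNN' _ [g xg] [h yh] <-].
  have [g ->] := completion_coset x N; have [h ->] := completion_coset y N.
  by exists (g * h); apply: lcoset_mul; exact: finNormal_normal.
by exists g; [exact: completion_sub xg|exists h => //; exact: completion_sub yh].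
Qed.

Lemma compatible_inv x : compatible (fun N => [set g^-1 | g in x N]).
Proof.
split=> [N|N N' sNN' _ [g xg] <-].
  have [g ->] := completion_coset x N.
  by exists g^-1; apply: lcoset_inv; exact: finNormal_normal.
by exists g => //; exact: completion_sub xg.
Qed.

Definition completion_one := Completion compatible_one.
Definition completion_mul x y := Completion (compatible_mul x y).
Definition completion_inv x := Completion (compatible_inv x).

Lemma completion_mulA : associative completion_mul.
Proof.
move=> x y z; apply: completionP => N /=.
have [a ->] := completion_coset x N; have [b ->] := completion_coset y N.
have [c ->] := completion_coset z N.
by rewrite !lcoset_mul ?mulgA //; exact: finNormal_normal.
Qed.

Lemma completion_mul1x : left_id completion_one completion_mul.
Proof.
move=> x; apply: completionP => N /=; have [a ->] := completion_coset x N.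
by rewrite lcoset_mul ?mul1g //; exact: finNormal_normal.
Qed.

Lemma completion_mulx1 : right_id completion_one completion_mul.
Proof.
move=> x; apply: completionP => N /=; have [a ->] := completion_coset x N.
by rewrite lcoset_mul ?mulg1 //; exact: finNormal_normal.
Qed.

Lemma completion_mulVx : left_inverse completion_one completion_inv completion_mul.
Proof.
move=> x; apply: completionP => N /=; have [a ->] := completion_coset x N.
by rewrite lcoset_inv ?lcoset_mul ?mulVg //; exact: finNormal_normal.
Qed.

Lemma completion_mulxV : right_inverse completion_one completion_inv completion_mul.
Proof.
move=> x; apply: completionP => N /=; have [a ->] := completion_coset x N.
by rewrite lcoset_inv ?lcoset_mul ?mulgV //; exact: finNormal_normal.
Qed.

HB.instance Definition _ := isGroup.Build Gh completion_mulA completion_mul1x completion_mulx1 completion_mulVx completion_mulxV.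

Lemma completionM x y N : (x * y) N = [set g * h | g in x N & h in y N].
Proof. by []. Qed.

Lemma completionV x N : x^-1 N = [set g^-1 | g in x N].
Proof. by []. Qed.

Lemma completion1 N : (1 : Gh) N = lcoset N 1.
Proof. by []. Qed.

HB.instance Definition _ := Topological.copy Gh
  (initial_topology (@completion_val G : Gh ->
     prod_topology (fun _ : finNormal G => discrete_topology (set G)))).

Lemma completion_near x N : nbhs x [set y : Gh | y N = x N].
Proof.
have c1 : continuous (@completion_val G : Gh ->
    prod_topology (fun _ : finNormal G => discrete_topology (set G))).
  exact: initial_continuous.
have c2 := @proj_continuous (finNormal G) (fun _ => discrete_topology (set G)) N.
have := continuous_comp (c1 x) (c2 _).
by move/(_ _ (discrete_set1 _)).
Qed.

Lemma completion_continuous (X : topologicalType) (f : X -> Gh) :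
  (forall N (t : X), \forall u \near t, f u N = f t N) -> continuous f.
Proof.
move=> cf; apply: continuous_comp_initial; apply: continuous_prod => N.
by apply: (iffRL (continuous_discrete _)) => t; exact: cf.
Qed.

Lemma completion_mul_continuous : continuous (fun xy : Gh * Gh => xy.1 * xy.2).
Proof.
apply: completion_continuous => N [x y].
exists ([set u : Gh | u N = x N], [set v : Gh | v N = y N]).
  by split; exact: completion_near.
by move=> [u v] [e1 e2]; rewrite /mkset [LHS]completionM [RHS]completionM /= e1 e2.
Qed.

Lemma completion_inv_continuous : continuous (fun x : Gh => x^-1).
Proof.
apply: completion_continuous => N x; apply: filterS (completion_near x N).
by move=> y e; rewrite [LHS]completionV [RHS]completionV e.
Qed.

HB.instance Definition _ := isTopGroup.Build Gh completion_mul_continuous completion_inv_continuous.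

Lemma compatible_to (g : G) : compatible (fun N : finNormal G => lcoset N g).
Proof.
by split=> [N|N N' sNN' _ [h Nh <-]]; [exists g|exists h => //; exact: sNN'].
Qed.

Definition to_completion (g : discrete_topology G) : Gh :=
  Completion (compatible_to g).

Lemma to_completionM : {morph to_completion : g h / g * h}.
Proof.
move=> g h; apply: completionP => N; rewrite completionM /=.
by rewrite lcoset_mul //; exact: finNormal_normal.
Qed.

Lemma to_completion_continuous : continuous to_completion.
Proof.
apply: completion_continuous => N g.
near=> h; have -> // : h = g.
by near: h; exact: (@discrete_set1 (discrete_topology G)).
Unshelve. all: by end_near.
Qed.

End Completion.

Section Cohomology.
Local Open Scope ring_scope.

Record action (K : groupType) (M : zmodType) := Action {
  act :> K -> M -> M;
  act1 : forall m, act 1%g m = m;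
  actM : forall g h m, act (g * h)%g m = act g (act h m);
  actD : forall g m m', act g (m + m') = act g m + act g m'
}.

Lemma act_is_additive (K : groupType) (M : zmodType) (a : action K M) g :
  zmod_morphism (a g).
Proof. by move=> m m'; apply: (@addIr _ (a g m')); rewrite -actD !subrK. Qed.

HB.instance Definition _ (K : groupType) (M : zmodType) (a : action K M) g :=
  GRing.isZmodMorphism.Build M M (a g) (act_is_additive a g).

Definition discrete_action (G : groupType) (M : zmodType) (a : action G M) :
    action (discrete_topology G) M :=
  @Action (discrete_topology G) M a (act1 a) (actM a) (actD a).

Section Complex.
Variables (K : topGroupType) (M : zmodType) (a : action K M).

Definition cochain_fun n := {ptws 'I_n.+1 -> K} -> M.

(* Homogeneous continuous cochains, M carrying the discrete topology. *)
Definition is_cochain n (f : cochain_fun n) :=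
  continuous (f : {ptws 'I_n.+1 -> K} -> discrete_topology M) /\
  forall g x, f (fun i => (g * x i)%g) = a g (f x).

Definition diff n (f : cochain_fun n) : cochain_fun n.+1 :=
  fun x => \sum_(i < n.+2) f (fun j => x (lift i j)) *~ (-1) ^+ i.

Lemma is_cochain0 n : is_cochain (0 : cochain_fun n).
Proof.
split; last by move=> g x; rewrite raddf0.
exact: cst_continuous.
Qed.

Lemma is_cochainB n (f h : cochain_fun n) :
  is_cochain f -> is_cochain h -> is_cochain (f - h).
Proof.
move=> [/continuous_discrete cf ef] [/continuous_discrete ch eh]; split.
  apply/continuous_discrete => x; apply: filterS2 (cf x) (ch x) => y fy hy.
  by rewrite -[LHS]/(f y - h y) fy hy.
by move=> g x; rewrite -[LHS]/(f _ - h _) ef eh -raddfB.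
Qed.

Lemma is_cochain_diff n (f : cochain_fun n) : is_cochain f -> is_cochain (diff f).
Proof.
move=> [/continuous_discrete cf ef]; split.
  apply/continuous_discrete => x.
  have cl (i : 'I_n.+2) : continuous
      ((fun y j => y (lift i j)) : {ptws 'I_n.+2 -> K} -> {ptws 'I_n.+1 -> K}).
    apply: continuous_prod => j.
    exact: (@proj_continuous 'I_n.+2 (fun=> K) (lift i j)).
  have : \forall y \near x, forall i : 'I_n.+2,
      f (fun j => y (lift i j)) = f (fun j => x (lift i j)).
    apply: (@filter_forall _ _ (fun (i : 'I_n.+2) (y : {ptws 'I_n.+2 -> K}) =>
      f (fun j => y (lift i j)) = f (fun j => x (lift i j))) (nbhs x)) => i.
    exact: (cl i x _ (cf (fun j => x (lift i j)))).
  by apply: filterS => y e; apply: eq_bigr => i _; rewrite e.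
by move=> g x; rewrite /diff raddf_sum; apply: eq_bigr => i _; rewrite ef raddfMz.
Qed.

Lemma diff0 n : diff (0 : cochain_fun n) = 0.
Proof. by apply/funext => x; rewrite /diff big1 // => i _; rewrite mul0rz. Qed.

Lemma diffB n : {morph @diff n : f h / f - h}.
Proof.
move=> f h; apply/funext => x; rewrite -[RHS]/(diff f x - diff h x) /diff.
by rewrite -sumrB; apply: eq_bigr => i _; rewrite -mulrzBl.
Qed.

Lemma diffK n (f : cochain_fun n) : diff (diff f) = 0.
Proof.
apply/funext => x.
pose F (i : 'I_n.+3) (j : 'I_n.+2) :=
  f (fun k => x (lift i (lift j k))) *~ (-1) ^+ (i + j).
have -> : diff (diff f) x = \sum_j \sum_i F i j.
  rewrite exchange_big /diff; apply: eq_bigr => i _.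
  rewrite mulrz_suml; apply: eq_bigr => j _.
  by rewrite /F /= -mulrzA -exprD addnC.
have -> : \sum_j \sum_i F i j =
    \sum_(j < n.+2) (\sum_(i < n.+2 | (i <= j)%N) F (widen_ord (leqnSn _) i) j +
            \sum_(i < n.+2 | (j <= i)%N) F (lift ord0 i) j).
  apply: eq_bigr => j _; rewrite (bigID (fun i : 'I_n.+3 => (i <= j)%N)) /=.
  congr (_ + _).
    by rewrite big_mkcond big_ord_recr /= leqNgt ltn_ord addr0 -big_mkcond.
  by rewrite big_mkcond big_ord_recl /= add0r -big_mkcond; apply: eq_bigl => i; rewrite -ltnNge.
rewrite big_split /= (exchange_big_dep predT) //= -big_split big1 // => i _.
rewrite -big_split big1 // => j /= ij.
rewrite /F /= /bump leq0n add1n addSn exprS mulN1r mulrNz addnC.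
suff -> : (fun k => x (lift (widen_ord (leqnSn n.+2) i) (lift j k))) =
          (fun k => x (lift (lift ord0 j) (lift i k))) by rewrite subrr.
apply/funext => k; congr x; apply: val_inj; rewrite /= /bump.
lia.
Qed.

Definition is_cocycle n (f : cochain_fun n) := is_cochain f /\ diff f = 0.

Definition is_coboundary n : cochain_fun n -> Prop :=
  if n is m.+1 then fun f => exists2 h : cochain_fun m, is_cochain h & f = diff h
  else fun f => f = 0.

Lemma is_coboundary0 n : is_coboundary (0 : cochain_fun n).
Proof.
by case: n => //= m; exists 0; [exact: is_cochain0|rewrite diff0].
Qed.

Lemma is_coboundaryB n (f h : cochain_fun n) :
  is_coboundary f -> is_coboundary h -> is_coboundary (f - h).
Proof.
case: n f h => [f h -> ->|m f h [u cu ->] [v cv ->]] /=; first by rewrite subrr.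
by exists (u - v); [exact: is_cochainB|rewrite diffB].
Qed.

Lemma coboundary_cocycle n (f : cochain_fun n) : is_coboundary f -> is_cocycle f.
Proof.
case: n f => [_ ->|n _ [h ch ->]]; last first.
  by split; [exact: is_cochain_diff|exact: diffK].
split; first exact: is_cochain0.
exact: diff0.
Qed.

Definition cocycle_pred n : {pred cochain_fun n} := fun f => `[< is_cocycle f >].

Lemma cocycle_pred_closed n : zmod_closed (@cocycle_pred n).
Proof.
split=> [|f h /asboolP[cf df] /asboolP[ch dh]]; apply/asboolP.
  split; [exact: is_cochain0|exact: diff0].
by split; [exact: is_cochainB|rewrite diffB df dh subrr].
Qed.

HB.instance Definition _ n :=
  GRing.isZmodClosed.Build (cochain_fun n) (@cocycle_pred n) (@cocycle_pred_closed n).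

End Complex.

Record cocycle (K : topGroupType) (M : zmodType) (a : action K M) n := Cocycle {
  cocycle_val :> cochain_fun K M n;
  cocycleP : cocycle_val \in @cocycle_pred K M a n
}.

Section CohomologyGroup.
Variables (K : topGroupType) (M : zmodType) (a : action K M) (n : nat).

HB.instance Definition _ := [isSub for @cocycle_val K M a n].
HB.instance Definition _ := [Choice of cocycle a n by <:].
HB.instance Definition _ := [SubChoice_isSubZmodule of cocycle a n by <:].

Definition coboundary_pred : {pred cocycle a n} := fun z => `[< is_coboundary a z >].

Lemma coboundary_pred_closed : zmod_closed coboundary_pred.
Proof.
split=> [|f h /asboolP bf /asboolP bh]; apply/asboolP.
  exact: is_coboundary0.
exact: is_coboundaryB.
Qed.

HB.instance Definition _ :=
  GRing.isZmodClosed.Build (cocycle a n) coboundary_pred coboundary_pred_closed.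

Definition cohomology := Quotient.quot coboundary_pred.

HB.instance Definition _ := GRing.Zmodule.on cohomology.

End CohomologyGroup.

(* The map induced by a continuous morphism phi : K -> L, for a K-module *)
(* structure on M that is the pullback along phi of an L-module structure. *)
Section Functoriality.
Variables (K L : topGroupType) (M : zmodType) (a : action K M) (b : action L M).
Variable phi : K -> L.
Hypothesis phiM : {morph phi : x y / (x * y)%g}.
Hypothesis phi_cont : continuous phi.
Hypothesis phi_act : forall g m, a g m = b (phi g) m.

Definition pullback_fun n (f : cochain_fun L M n) : cochain_fun K M n :=
  fun x => f (fun i => phi (x i)).

Lemma pullback_cochain n (f : cochain_fun L M n) :
  is_cochain b f -> is_cochain a (pullback_fun f).
Proof.
move=> [/continuous_discrete cf ef]; split; last first.
  by move=> g x; rewrite phi_act -ef; congr f; apply/funext => i; exact: phiM.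
apply/continuous_discrete => x.
have cl : continuous
   ((fun y i => phi (y i)) : {ptws 'I_n.+1 -> K} -> {ptws 'I_n.+1 -> L}).
  apply: continuous_prod => j y U nU.
  exact: (@proj_continuous 'I_n.+1 (fun=> K) j y _ (@phi_cont (y j) U nU)).
exact: (cl x _ (cf (fun i => phi (x i)))).
Qed.

Lemma pullback_diff n (f : cochain_fun L M n) :
  diff (pullback_fun f) = pullback_fun (diff f).
Proof. by []. Qed.

Lemma pullback_cocycle n (z : cocycle b n) :
  pullback_fun (cocycle_val z) \in @cocycle_pred K M a n.
Proof.
apply/asboolP; have /asboolP[cz dz] := cocycleP z.
by split; [exact: pullback_cochain|rewrite pullback_diff dz].
Qed.

Definition pullback n (z : cocycle b n) : cocycle a n :=
  Cocycle (pullback_cocycle z).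

Lemma pullbackB n : {morph @pullback n : z w / z - w}.
Proof. by move=> z w; apply: val_inj. Qed.

Lemma pullback_coboundary n (z : cocycle b n) :
  is_coboundary b z -> is_coboundary a (pullback z).
Proof.
rewrite /=; move: (cocycle_val z) => {z}; case: n => [f ->|n f [h ch ->]] //.
by exists (pullback_fun h) => //; exact: pullback_cochain.
Qed.

Definition cohomology_map n (c : cohomology b n) : cohomology a n :=
  \pi_(cohomology a n) (pullback (repr c)).

Lemma cohomology_map_pi n (z : cocycle b n) :
  cohomology_map (\pi_(cohomology b n) z) = \pi_(cohomology a n) (pullback z).
Proof.
apply/eqP; rewrite -Quotient.idealrBE -pullbackB; apply/asboolP.
apply: pullback_coboundary; apply/asboolP.
suff : repr (\pi_(cohomology b n) z) - z \in @coboundary_pred L M b n by [].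
by rewrite Quotient.idealrBE reprK.
Qed.

Lemma cohomology_map_is_additive n : zmod_morphism (@cohomology_map n).
Proof.
move=> c d; rewrite -[c]reprK -[d]reprK -raddfB !cohomology_map_pi.
by rewrite pullbackB raddfB.
Qed.

HB.instance Definition _ n :=
  GRing.isZmodMorphism.Build (cohomology b n) (cohomology a n)
    (@cohomology_map n) (@cohomology_map_is_additive n).

End Functoriality.
End Cohomology.

Section Goodness.
Variables (G : groupType) (M : finZmodType) (a : action G M).

Definition act_ker : set G := [set g | forall m, a g m = m].

Lemma act_cancel g : cancel (a g) (a g^-1).
Proof. by move=> m; rewrite -actM mulVg act1. Qed.

Lemma act_ker_normal : normal_subgroup act_ker.
Proof.
split; first split=> [m|x y kx ky m|x kx m]; first exact: act1.
- by rewrite actM ky kx.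
- by rewrite -{1}(kx m) act_cancel.
by move=> x g kx m; rewrite conjgE !actM kx act_cancel.
Qed.

Lemma lcoset_act_ker g : lcoset act_ker g = [set h | forall m, a h m = a g m].
Proof.
apply/seteqP; split=> [_ [k kk <-] m|h gh]; first by rewrite actM kk.
by exists (g^-1 * h); [move=> m; rewrite actM gh act_cancel|rewrite mulgA mulgV mul1g].
Qed.

Lemma act_ker_index : finite_index act_ker.
Proof.
pose Phi (u : {ffun M -> M}) : set G := [set h | forall m, a h m = u m].
apply: (@sub_finite_set _ _ (Phi @` setT)); last exact/finite_image/finite_finset.
move=> _ [g _ <-]; exists [ffun m => a g m] => //; rewrite lcoset_act_ker.
by apply/seteqP; split=> h gh m; have := gh m; rewrite ffunE.
Qed.

Definition action_ker := FinNormal act_ker_normal act_ker_index.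

(* The action of G on the finite module M factors through G / act_ker, hence *)
(* through the completion: x acts as any element of its coset at act_ker. *)
Definition completion_act (x : completion G) (m : M) : M :=
  a (xget 1 (x action_ker)) m.

Lemma completion_actE (x : completion G) g m : x action_ker g -> completion_act x m = a g m.
Proof.
have [h e] := completion_coset x action_ker.
move=> xg; have := xgetI 1%g xg; rewrite /completion_act.
move: (xget _ _) xg => k; rewrite e /= lcoset_act_ker /= => gm km.
by rewrite gm km.
Qed.

Lemma completion_rep (x : completion G) : exists g, x action_ker g.
Proof.
have [g ->] := completion_coset x action_ker; exists g, 1; last exact: mulg1.
by have [[]] := act_ker_normal.
Qed.

Lemma completion_act1 m : completion_act 1 m = m.
Proof.
rewrite (@completion_actE 1 1) ?act1 //; exists 1; last exact: mulg1.
by have [[]] := act_ker_normal.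
Qed.

Lemma completion_actM x y m :
  completion_act (x * y) m = completion_act x (completion_act y m).
Proof.
have [g xg] := completion_rep x; have [h yh] := completion_rep y.
rewrite (completion_actE _ xg) (completion_actE _ yh) -actM.
by apply: completion_actE; exists g => //; exists h.
Qed.

Lemma completion_actD x m m' :
  completion_act x (m + m')%R = (completion_act x m + completion_act x m')%R.
Proof. exact: actD. Qed.

Definition completion_action : action (completion G) M :=
  Action completion_act1 completion_actM completion_actD.

Lemma completion_action_continuous m :
  continuous (completion_action^~ m : completion G -> discrete_topology M).
Proof.
apply: (iffRL (continuous_discrete _)) => x.
apply: filterS (completion_near x action_ker) => y e.
by rewrite /= /completion_act e.
Qed.

Lemma completion_action_to (g : discrete_topology G) m :
  discrete_action a g m = completion_action (to_completion g) m.
Proof.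
symmetry; apply: completion_actE; exists 1; last exact: mulg1.
by have [[]] := act_ker_normal.
Qed.

Definition comparison n :
    cohomology completion_action n ->
    cohomology (discrete_action a) n :=
  @cohomology_map _ _ _ _ _ _ (@to_completionM G) (@to_completion_continuous G)
    completion_action_to n.

HB.instance Definition _ n := GRing.Additive.on (@comparison n).

End Goodness.

Definition p_primary (p : nat) (M : zmodType) :=
  forall m : M, exists k, (m *+ (p ^ k)%N = 0)%R.

(* The comparison map is additive, so it is an isomorphism iff it is bijective. *)
Definition good (G : groupType) :=
  forall p, prime p -> forall n (M : finZmodType) (a : action G M),
    p_primary p M -> bijective (@comparison G M a n).

(* Main.v *)
Require Import Defs.
From HB Require Import structures.
From mathcomp Require Import all_boot all_algebra ring_quotient zify.
From mathcomp Require Import boolp classical_sets functions.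
From mathcomp Require Import cardinality topology function_spaces.

Set Implicit Arguments.
Unset Strict Implicit.
Unset Printing Implicit Defensive.
Import GRing.Theory.
Local Open Scope classical_set_scope.
Local Open Scope group_scope.
Local Open Scope ring_scope.

(* Goodness follows once every class of degree >= 1 with finite coefficients  *)
(* dies in a finite-index subgroup; the passage is a zigzag in the double     *)
(* complex of G-equivariant functions f (x_0 .. x_p) (y_0 .. y_q) that are    *)
(* constant modulo a finite-index subgroup in the y_i.                        *)
(*   Let F be free, G / F generated by t. Degree 1 is easy: a derivation into *)
(* a finite module vanishes on the kernel of an affine action. As F has       *)
(* cohomological dimension 1, a cocycle f of degree p >= 2 is d h with h      *)
(* F-equivariant, and the obstruction to the t-equivariance of h is the       *)
(* cocycle t.h - h of degree p - 1. For p >= 3 it is in turn d k, and k can   *)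
(* be written t.m - m when t has infinite order modulo F, so h - d m works.   *)
(* For p = 2 the F-equivariant 1-cocycles V form a closed shift-invariant     *)
(* subgroup of (B ^ S) ^ int, where S is a finite generating set of G and B   *)
(* the coefficient module. Such a group shift is of finite type, so an        *)
(* element of V that vanishes on a long window splits into two elements of V, *)
(* vanishing on a left and on a right half-line; these are of the form        *)
(* t^l.e - e. By the pigeonhole principle some t^l.h - h is, up to a shift,   *)
(* such an element, so h can be corrected to be F<t^l>-equivariant.           *)

(** By density and compactness, continuous cochains of the completion are the cochains of [G] that
    are constant modulo some finite-index normal subgroup ([pullback_inj], [continuous_uniform],
    [uniform_extension]). Goodness thus compares uniform with arbitrary cochains, and
    [effaceable_good] is Serre's criterion: it suffices that classes of positive degree die on
    finite-index subgroups. Surjectivity is [uniform_representative] and injectivity is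
    [uniform_primitive]; both chase the double complex, which is exact in positive degree in either
    direction ([dy_exact], and [bd_exact], the latter by effaceability).

    [free_by_cyclic_effaceable] verifies the criterion. Since free groups have cohomological
    dimension 1 ([free_coboundary]), a cocycle has an [F]-equivariant primitive, and only invariance
    under some power of [t] remains to be arranged. The hard case is degree 2, governed by the
    cohomology of the integers in the 1-cocycles of [F]. These may form an infinite group when [F]
    has infinite rank, but finite generation of [G] makes them a compact group shift over a finite
    alphabet, and [edge_cocycle_shift_coboundary] trivializes the obstruction on the multiples of
    some [l > 0]. *)

Inductive zexpr := ZVar of nat | ZZero | ZAdd of zexpr & zexpr | ZOpp of zexpr.

Fixpoint zeval (B : zmodType) (env : seq B) e :=
  match e with
  | ZVar n => env`_n
  | ZZero => 0
  | ZAdd e1 e2 => zeval env e1 + zeval env e2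
  | ZOpp e1 => - zeval env e1
  end.

Fixpoint zcoef e i : int :=
  match e with
  | ZVar n => (n == i)%:Z
  | ZZero => 0
  | ZAdd e1 e2 => zcoef e1 i + zcoef e2 i
  | ZOpp e1 => - zcoef e1 i
  end.

Lemma zevalE (B : zmodType) (env : seq B) e :
  zeval env e = \sum_(i < size env) env`_i *~ zcoef e i.
Proof.
elim: e => [n||e1 IH1 e2 IH2|e1 IH1] /=.
- have [n_env|env_n] := ltnP n (size env); last first.
    rewrite nth_default // big1 // => i _; rewrite gtn_eqF ?mulr0z //.
    exact: leq_trans (ltn_ord i) env_n.
  rewrite (bigD1 (Ordinal n_env)) //= eqxx mulr1z big1 ?addr0 // => i.
  by rewrite -val_eqE /= eq_sym => /negPf ->; rewrite mulr0z.
- by rewrite big1 // => i _; rewrite mulr0z.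
- by rewrite IH1 IH2 -big_split; apply: eq_bigr => i _; rewrite mulrzDr.
- by rewrite IH1 -sumrN; apply: eq_bigr => i _; rewrite mulrNz.
Qed.

Lemma zmod_normalize (B : zmodType) (env : seq B) e1 e2 :
  all (fun i => zcoef e1 i == zcoef e2 i) (iota 0 (size env)) ->
  zeval env e1 = zeval env e2.
Proof.
move=> /allP e12; rewrite !zevalE; apply: eq_bigr => i _; congr (_ *~ _).
by apply/eqP/e12; rewrite mem_iota /= ltn_ord.
Qed.

(** Atoms are identified up to conversion, so two terms that differ by unfolding share one
    variable. *)
Ltac zmod_atoms t env :=
  lazymatch t with
  | (?u + ?v)%R => let env' := zmod_atoms u env in zmod_atoms v env'
  | (- ?u)%R => zmod_atoms u env
  | 0%R => env
  | _ => match constr:(tt) with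
         | _ => let _ := zmod_mem t env in env
         | _ => constr:(t :: env)
         end
  end
with zmod_mem t env :=
  lazymatch env with
  | ?y :: ?env' =>
    match constr:(tt) with
    | _ => let _ := match constr:(tt) with _ => unify t y end in constr:(tt)
    | _ => zmod_mem t env'
    end
  end.

Ltac zmod_index t env :=
  lazymatch env with
  | ?y :: ?env' =>
    match constr:(tt) with
    | _ => let _ := match constr:(tt) with _ => unify t y end in constr:(0%N)
    | _ => let n := zmod_index t env' in constr:(n.+1)
    end
  end.

Ltac zmod_reify t env :=
  lazymatch t with
  | (?u + ?v)%R =>
    let u' := zmod_reify u env in let v' := zmod_reify v env in constr:(ZAdd u' v')
  | (- ?u)%R => let u' := zmod_reify u env in constr:(ZOpp u')
  | 0%R => constr:(ZZero)
  | _ => let n := zmod_index t env in constr:(ZVar n)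
  end.

Ltac zmod :=
  lazymatch goal with
  | |- @eq ?B ?u ?v =>
    let env := zmod_atoms u (@nil B) in
    let env := zmod_atoms v env in
    let u' := zmod_reify u env in
    let v' := zmod_reify v env in
    exact (@zmod_normalize _ env u' v' isT)
  end.

(** * Homogeneous cochains as functions of sequences *)

Section ListCochains.
Variable T : Type.

(** The alternating sum of the faces ([bd_sum]), in recursive form: drop the first vertex, or keep
    it and differentiate in the others. One function on sequences carries all degrees, and the
    complex is augmented: [bd f [:: x]] is [f [::]]. *)
Fixpoint bd (B : zmodType) (f : seq T -> B) (s : seq T) : B :=
  if s is x :: s' then f s' - bd (fun r => f (x :: r)) s' else 0.

Lemma bd_morph (B C : zmodType) (L : B -> C) (f : seq T -> B) s :
  {morph L : x y / x - y} -> bd (fun r => L (f r)) s = L (bd f s).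
Proof.
move=> LB; elim: s f => [|x s IHs] f /=; last by rewrite LB -IHs.
by rewrite -[X in L X](subrr 0) LB subrr.
Qed.

Lemma bd_raddf (B C : zmodType) (L : {additive B -> C}) (f : seq T -> B) s :
  bd (fun r => L (f r)) s = L (bd f s).
Proof. exact/bd_morph/raddfB. Qed.

Lemma bdB (B : zmodType) (f h : seq T -> B) s :
  bd (fun r => f r - h r) s = bd f s - bd h s.
Proof.
elim: s f h => [|x s IHs] f h /=; first by rewrite subr0.
by rewrite IHs !opprB addrACA [RHS]addrACA [- h s + _]addrC.
Qed.

Lemma bd0 (B : zmodType) s : bd (fun=> 0 : B) s = 0.
Proof. by elim: s => [|x s IHs] //=; rewrite IHs subr0. Qed.

Lemma bdN (B : zmodType) (f : seq T -> B) s : bd (fun r => - f r) s = - bd f s.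
Proof.
by have := bdB (fun=> 0) f s; rewrite bd0 sub0r => <-; congr bd; apply/funext => r; rewrite sub0r.
Qed.

Lemma bdD (B : zmodType) (f h : seq T -> B) s :
  bd (fun r => f r + h r) s = bd f s + bd h s.
Proof.
by rewrite -[bd h s]opprK -bdN -bdB; congr bd; apply/funext => r; rewrite opprK.
Qed.

Lemma bd_eval (U : Type) (B : zmodType) (f : seq T -> U -> B) s u :
  bd f s u = bd (fun r => f r u) s.
Proof.
elim: s f => [|x s IHs] f //=.
by rewrite -[LHS]/(f s u - bd (fun r => f (x :: r)) s u) IHs.
Qed.

Lemma bd_bd (B : zmodType) (f : seq T -> B) s : bd (bd f) s = 0.
Proof.
elim: s f => [|x s IHs] f //=.
by rewrite bdB IHs subr0 subrr.
Qed.

Lemma bd_map (B : zmodType) (f : seq T -> B) (u : T -> T) s :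
  bd f (map u s) = bd (fun r => f (map u r)) s.
Proof. by elim: s f => [|x s IHs] f //=; rewrite IHs. Qed.

Lemma bd_congr (U : Type) (B : zmodType) (k : T -> U) (f h : seq T -> B) s r :
  (forall s r, map k s = map k r -> f s = h r) ->
  map k s = map k r -> bd f s = bd h r.
Proof.
elim: s r f h => [|x s IHs] [|y r] f h //= fh [kxy ksr].
rewrite (fh s r) //; congr (_ - _); apply: IHs => // s' r' e.
by apply: fh => /=; rewrite kxy e.
Qed.

Definition supported (B : zmodType) (n : nat) (f : seq T -> B) :=
  forall s, size s != n -> f s = 0.

Lemma bd_supported (B : zmodType) n (f : seq T -> B) :
  supported n f -> supported n.+1 (bd f).
Proof.
move=> fn s; elim: s n f fn => [|x s IHs] n f fn //= sn.
rewrite fn ?sub0r; last by apply: contra sn => /eqP ->.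
case: n fn sn => [|n] fn sn; last by rewrite (IHs n) ?oppr0 // => r rn; apply: fn.
rewrite (_ : (fun r => _) = fun=> 0) ?bd0 ?oppr0 //.
by apply/funext => r; exact: fn.
Qed.

(** Values of [h] off length [n] only affect [bd h] off length [n.+1], where [f] vanishes. *)
Lemma bd_truncate (B : zmodType) n (f h : seq T -> B) :
  supported n.+1 f -> bd h = f ->
  bd (fun s => if size s == n then h s else 0) = f.
Proof.
move=> fn hf; apply/funext => s; have [sn|/[dup] sn /fn ->] := eqVneq (size s) n.+1; last first.
  by apply: (@bd_supported _ n) => // r /negPf ->.
rewrite -hf; elim: s n sn h {f fn hf} => [|x s IHs] n //= [sn] h.
rewrite sn eqxx; congr (_ - _); case: n sn => [|n] sn; first by case: s sn {IHs}.
by rewrite -[RHS](IHs n).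
Qed.

End ListCochains.

(** * Free groups *)

Section Derivations.
Variables (G : groupType) (F : set G).
Hypothesis F_normal : normal_subgroup F.

Definition normal_sub1 : F 1%g. Proof. by have [[]] := F_normal. Qed.
Definition normal_subM x y : F x -> F y -> F (x * y)%g.
Proof. by have [[_ + _] _] := F_normal; apply. Qed.
Definition normal_subV x : F x -> F x^-1%g.
Proof. by have [[_ _ +] _] := F_normal; apply. Qed.
Definition normal_subJ x g : F x -> F (x ^ g)%g.
Proof. by have [_ +] := F_normal; apply. Qed.

Definition semidirect (B : zmodType) (a : action G B) : Type := (B * G)%type.

Section Semidirect.
Variables (B : zmodType) (a : action G B).
Local Notation semidirect := (semidirect a).

HB.instance Definition _ := Choice.copy semidirect (B * G)%type.

Definition sd_mul (u v : semidirect) : semidirect := (u.1 + a u.2 v.1, (u.2 * v.2)%g).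
Definition sd_inv (u : semidirect) : semidirect := (- a u.2^-1%g u.1, u.2^-1%g).

Lemma sd_mulA : associative sd_mul.
Proof. by move=> u v w; rewrite /sd_mul /= actD actM addrA mulgA. Qed.
Lemma sd_mul1 : left_id (0, 1%g) sd_mul.
Proof. by case=> b g; rewrite /sd_mul /= act1 add0r mul1g. Qed.
Lemma sd_mulr1 : right_id (0, 1%g) sd_mul.
Proof. by case=> b g; rewrite /sd_mul /= raddf0 addr0 mulg1. Qed.
Lemma sd_mulV : left_inverse (0, 1%g) sd_inv sd_mul.
Proof. by case=> b g; rewrite /sd_mul /= addNr mulVg. Qed.
Lemma sd_mulVr : right_inverse (0, 1%g) sd_inv sd_mul.
Proof. by case=> b g; rewrite /sd_mul /= raddfN /= -actM mulgV act1 subrr. Qed.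

HB.instance Definition _ := isGroup.Build semidirect sd_mulA sd_mul1 sd_mulr1 sd_mulV sd_mulVr.

Lemma sd_mulE (u v : semidirect) : (u * v)%g = (u.1 + a u.2 v.1, (u.2 * v.2)%g).
Proof. by []. Qed.
End Semidirect.

(* For F acting on G by left translations, these are the 1-cocycles of F with *)
(* values in B, transported to G: (x, y) |-> D y - D x is F-equivariant.      *)
Definition derivation (B : zmodType) (a : action G B) (D : G -> B) :=
  forall g x, F g -> D (g * x)%g = D g + a g (D x).

(** A derivation [D] is the same as a morphism [x |-> (D x, x)] into the semidirect product, so both
    halves come from the universal property; the second component is the identity on [F] because it
    is so on [X]. *)
Lemma derivation_free X : free_basis F X -> forall (B : zmodType) (a : action G B) (u : G -> B),
  (exists D : G -> B, (forall x y, F x -> F y -> D (x * y)%g = D x + a x (D y)) /\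
     forall x, X x -> D x = u x) /\
  (forall D E : G -> B, (forall x y, F x -> F y -> D (x * y)%g = D x + a x (D y)) ->
     (forall x y, F x -> F y -> E (x * y)%g = E x + a x (E y)) ->
     (forall x, X x -> D x = E x) -> forall x, F x -> D x = E x).
Proof.
move=> [XF freeX] B a u; pose K : groupType := semidirect a.
split.
  have [[phi [phiM phiX]] _] := freeX K (fun g => (u g, g) : K).
  have phi2 : forall x, F x -> (phi x).2 = x.
    have [_] := freeX G id; apply=> //.
      by move=> x y Fx Fy; rewrite phiM //.
    by move=> x Xx; rewrite phiX.
  exists (fun g => (phi g).1); split=> [x y Fx Fy|x /phiX -> //].
  by rewrite phiM // sd_mulE /= phi2.
move=> D E DM EM DE x Fx.
have [_ /(_ (fun x => (D x, x) : K) (fun x => (E x, x) : K))] := freeX K (fun g => (D g, g) : K).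
move=> H; suff [] : ((D x, x) : K) = (E x, x) by [].
apply: H => //.
- by move=> y z Fy Fz; rewrite sd_mulE /= DM.
- by move=> y z Fy Fz; rewrite sd_mulE /= EM.
- by move=> y Xy; rewrite DE.
Qed.

Lemma right_transversal : exists c : G -> G,
  [/\ forall x, F (x * (c x)^-1)%g, forall g x, F g -> c (g * x)%g = c x,
      forall x, F x -> c x = 1%g & forall x, c (c x) = c x].
Proof.
pose c x := if asbool (F x) then 1%g else xget 1%g [set y | F (x * y^-1)%g].
have cF x : F (x * (c x)^-1)%g.
  rewrite /c; case: asboolP => Fx; first by rewrite invg1 mulg1.
  set P := [set y | _]; suff : P (xget 1%g P) by [].
  by apply: (@xgetI _ 1%g P x); rewrite /P /= mulgV; exact: normal_sub1.
have cM g x : F g -> c (g * x)%g = c x.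
  move=> Fg; have gF z : F (g * z)%g = F z.
    apply/propext; split=> [/(normal_subM (normal_subV Fg))|/(normal_subM Fg) //]; by rewrite mulKg.
  rewrite /c gF (_ : [set y | _] = [set y | F (x * y^-1)%g]) //.
  by apply/seteqP; split=> y /=; rewrite -mulgA gF.
exists c; split=> // [x Fx|x]; first by rewrite /c asboolT.
by rewrite -{2}[x](mulgVK (c x)) cM.
Qed.

(** Under left translation [G] is a free [F]-set on the coset representatives. A derivation can
    therefore be prescribed freely on the basis of [F] and on the representatives outside [F]; the
    coset [F] itself is represented by 1, where every derivation vanishes. *)
Lemma derivation_extension : (exists X, free_basis F X) ->
  exists Y : set G, forall (B : zmodType) (a : action G B),
  (forall u : G -> B, exists2 D, derivation a D & forall x, Y x -> D x = u x) /\
  (forall D E, derivation a D -> derivation a E ->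
     (forall x, Y x -> D x = E x) -> D = E).
Proof.
move=> [X freeX]; have [XF _] := freeX; have [c [cF cM c1 cK]] := right_transversal.
exists [set x | X x \/ c x = x /\ ~ F x] => B a.
split=> [u|D E dD dE DE].
  have [[D [DM DX]] _] := @derivation_free X freeX B a u.
  pose v x := if asbool (F x) then 0 else u x.
  exists (fun x => D (x * (c x)^-1)%g + a (x * (c x)^-1)%g (v (c x))).
    have v1 : v 1%g = 0 by rewrite /v asboolT //; exact: normal_sub1.
    move=> g x Fg; rewrite cM // (c1 _ Fg) -mulgA invg1 mulg1 v1.
    by rewrite (DM _ _ Fg (cF x)) raddf0 addr0 actD (actM a g) addrA.
  move=> x [Xx|[-> nFx]].
    by rewrite (c1 _ (XF _ Xx)) /v asboolT ?raddf0 ?addr0 ?invg1 ?mulg1 ?DX//; exact: normal_sub1.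
  rewrite mulgV act1 /v asboolF // -[RHS]add0r; congr (_ + _).
  have /esym := DM _ _ normal_sub1 normal_sub1; rewrite mulg1 act1 -{3}[D 1%g]addr0.
  by move/addrI.
have DEF x : F x -> D x = E x.
  have [_] := @derivation_free X freeX B a D.
  by apply=> [y z|y z|y] // *; [apply: dD|apply: dE|apply: DE; left].
apply/funext => x; rewrite -[x](mulgVK (c x)) dD // dE // DEF //; congr (_ + a _ _).
have [Fc|nFc] := pselect (F (c x)); first exact: DEF.
by apply: DE; right.
Qed.

End Derivations.

Section FreeCoboundary.
Variables (G : groupType) (B : zmodType) (a : action G B).

Definition equivariant (H : set G) (f : seq G -> B) :=
  forall g s, H g -> f [seq (g * x)%g | x <- s] = a g (f s).

Definition translate (g : G) (u : seq G -> B) : seq G -> B :=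
  fun s => a g (u [seq (g^-1 * x)%g | x <- s]).

Lemma map_mulgK (g : G) s : [seq (g^-1 * x)%g | x <- [seq (g * x)%g | x <- s]] = s.
Proof. by rewrite -map_comp -[RHS]map_id; apply: eq_map => x /=; rewrite mulKg. Qed.

Lemma map_mulgM (g h : G) s :
  [seq (g * h * x)%g | x <- s] = [seq (g * x)%g | x <- [seq (h * x)%g | x <- s]].
Proof. by rewrite -map_comp; apply: eq_map => x /=; rewrite mulgA. Qed.

Lemma map_mul1g (s : seq G) : [seq (1 * x)%g | x <- s] = s.
Proof. by rewrite -[RHS]map_id; apply: eq_map => x; rewrite mul1g. Qed.

Lemma map_mulgVK (g : G) s : [seq (g * x)%g | x <- [seq (g^-1 * x)%g | x <- s]] = s.
Proof. by rewrite -map_mulgM mulgV map_mul1g. Qed.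

Lemma translate1 u : translate 1%g u = u.
Proof. by apply/funext => s; rewrite /translate act1 invg1 map_mul1g. Qed.

Lemma translateM g h u : translate (g * h)%g u = translate g (translate h u).
Proof. by apply/funext => s; rewrite /translate actM invgM map_mulgM. Qed.

Lemma translateD g u v : translate g (u + v) = translate g u + translate g v.
Proof. by apply/funext => s; rewrite -[RHS]/(_ + _) -actD. Qed.

Definition translation : action G (seq G -> B) := Action translate1 translateM translateD.

Lemma translationE g u s : translation g u s = a g (u [seq (g^-1 * x)%g | x <- s]).
Proof. by []. Qed.

Lemma bd_translation g u : bd (translation g u) = translation g (bd u).
Proof. by apply/funext => s; rewrite translationE bd_map -bd_raddf. Qed.

Lemma equivariantP H f :
  equivariant H f <-> forall g, H g -> translation g f = f.
Proof.
split=> [ef g Hg|ef g s Hg]; last by rewrite -{1}(ef g Hg) translationE map_mulgK.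
by apply/funext => s; rewrite translationE -ef // map_mulgVK.
Qed.

Lemma equivariant_bd H f : equivariant H f -> equivariant H (bd f).
Proof.
by move=> /equivariantP ef; apply/equivariantP => g Hg; rewrite -bd_translation ef.
Qed.

Lemma equivariantB H f h : equivariant H f -> equivariant H h -> equivariant H (f - h).
Proof. by move=> ef eh g s Hg; rewrite -[LHS]/(f _ - h _) ef // eh // -raddfB. Qed.

Lemma bd_funB (f h : seq G -> B) : bd (f - h) = bd f - bd h.
Proof. by apply/funext => s; rewrite -[f - h]/(fun r => f r - h r) bdB. Qed.

(* Free groups have cohomological dimension 1: D extends the edge values       *)
(* y |-> f (1 :: y :: _) from the tree of F to all paths, and h sums f along   *)
(* the path between the first two vertices of a simplex.                       *)
Lemma free_coboundary F : normal_subgroup F -> (exists X, free_basis F X) ->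
  forall f, equivariant F f -> bd f = 0 ->
    (forall s, (size s <= 2)%N -> f s = 0) ->
  exists h, [/\ equivariant F h, bd h = f & forall s, (size s <= 1)%N -> h s = 0].
Proof.
move=> nF freeF f ef df f2.
have [Y /(_ _ translation)[extD uniqD]] := derivation_extension nF freeF.
(* [D y] is to be a primitive of [f (1 :: s) - f (y :: s)]. For [y] in [Y] the prism [f
   [:: 1, y & s]] is one, by the cocycle identity, and the derivation rule propagates it to all of
   [G]. *)
have [D dD DY] := extD (fun y s => f [:: 1%g, y & s]).
have bdf x s : bd (fun r => f (x :: r)) s = f s.
  by apply/esym/eqP; rewrite -subr_eq0; apply/eqP; exact: (congr1 (@^~ (x :: s)) df).
have bdD x : bd (D x) = (fun s => f (1%g :: s) - f (x :: s)).
  move: x; suff : (fun x => bd (D x)) = (fun x s => f (1%g :: s) - f (x :: s)).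
    by move=> e x; exact: (congr1 (@^~ x) e).
  apply: uniqD => [g x Fg|g x Fg|y Yy].
  - by rewrite dD // -bd_translation; apply/funext => s; rewrite bdD.
  - apply/funext => s; rewrite -[RHS]/(_ + translation g _ s) translationE raddfB /=.
    by rewrite -!ef //= mulg1 map_mulgVK addrA subrK.
  apply/funext => s; rewrite DY //.
  by have := bdf 1%g (y :: s) => /= <-; rewrite subKr.
(* Coning [f] at the first vertex is equivariant, but the face that omits this vertex [x] is coned
   at [y] instead; [D y - D x] compensates for the change of cone point. *)
pose h s := if s is [:: x, y & r] then f [:: x, x, y & r] - (D y - D x) (y :: r) else 0.
exists h; split=> [g [|x[|y s]] Fg /=||[|x[|y s]] //]; rewrite ?raddf0 //.
  have -> : D (g * y)%g - D (g * x)%g = translation g (D y - D x).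
    by rewrite !dD // opprD addrACA subrr add0r raddfB.
  rewrite translationE -!map_cons map_mulgK ef //; exact/esym/raddfB.
have dgn z s : bd (fun r => f [:: z, z & r]) s = 0.
  by have := bdf z (z :: s) => /=; move/(canRL (subrK _)); rewrite -{1}[f _]addr0 => /addrI.
apply/funext => -[|x [|y [|z s]]].
- by rewrite f2.
- by rewrite f2 //= subrr.
- by rewrite f2 //= !subrr.
have dD2 : bd (fun r => (D y - D x) (y :: r)) (z :: s) =
    (D y - D x) (z :: s) - (f [:: x, y, z & s] - f [:: y, y, z & s]).
  have : bd (D y - D x) [:: y, z & s] = f [:: x, y, z & s] - f [:: y, y, z & s].
    by rewrite bd_funB -[LHS]/(bd (D y) _ - bd (D x) _) !bdD; zmod.
  by rewrite /= => <-; zmod.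
have df2 : bd (fun r => f [:: x, x, y & r]) (z :: s) = f [:: x, x, z & s].
  by apply/esym/eqP; rewrite -subr_eq0; apply/eqP; exact: (dgn x [:: y, z & s]).
have -> : bd h [:: x, y, z & s] = h [:: y, z & s] - (h [:: x, z & s] -
    bd (fun r => f [:: x, x, y & r] - (D y - D x) (y :: r)) (z :: s)) by [].
have DE u v r : (D u - D v) r = D u r - D v r by [].
by rewrite bdB dD2 df2 /h !DE; zmod.
Qed.
End FreeCoboundary.

(** * Edge cocycles as a group shift *)

Lemma ultra_ex2 (I : Type) (U : set_system I) (P Q : set I) : UltraFilter U ->
  U P -> U Q -> exists i, P i /\ Q i.
Proof. by move=> UU UP UQ; have [i] := filter_ex (filterI UP UQ); exists i. Qed.

Lemma ultra_ex3 (I : Type) (U : set_system I) (P Q R : set I) : UltraFilter U ->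
  U P -> U Q -> U R -> exists i, [/\ P i, Q i & R i].
Proof.
move=> UU UP UQ UR; have [i [Pi [Qi Ri]]] := ultra_ex2 UU UP (filterI UQ UR).
by exists i.
Qed.

Section Ultrafilters.
Variables (I : Type) (U : set_system I).
Hypothesis UU : UltraFilter U.

Lemma ultra_const (T : finType) (u : I -> T) : exists b, U [set i | u i = b].
Proof.
apply: contrapT => /forallNP nU.
have : \forall i \near U, forall b, u i != b.
  apply: filter_forall => b; have [/nU //|] := in_ultra_setVsetC [set i | u i = b] UU.
  by apply: filterS => i /= /eqP.
by move=> /filter_ex[i /(_ (u i))]; rewrite eqxx.
Qed.

Lemma ultra_const_fun (J T : finType) (u : I -> J -> T) : exists b, U [set i | u i = b].
Proof.
have [b Ub] := boolp.choice (fun j => ultra_const (u^~ j)).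
exists b; have : \forall i \near U, forall j, u i j = b j by exact: filter_forall.
by apply: filterS => i /funext.
Qed.

End Ultrafilters.

Section IntegerPowers.
Variables (G : groupType) (t : G).

Definition zpow (j : int) : G := match j with Posz n => t ^+ n | Negz n => t ^- n.+1 end.

Lemma zpow_sub m n : zpow (m%:Z - n%:Z) = (t ^+ m / t ^+ n)%g.
Proof.
have [nm|mn] := leqP n m; first by rewrite subzn //= expgnFr.
rewrite -opprB subzn ?(ltnW mn) // -[RHS]invgK invgF -expgnFr ?(ltnW mn) //.
by rewrite -(ltn_predK (_ : 0 < n - m)%N) ?subn_gt0.
Qed.

Lemma zpowD j k : zpow (j + k) = (zpow j * zpow k)%g.
Proof.
have diff (i : int) : exists m n : nat, i = m%:Z - n%:Z.
  case: i => n; first by exists n, 0%N; rewrite subr0.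
  by exists 0%N, n.+1; rewrite sub0r NegzE.
have [[m [n ->]] [p [q ->]]] := (diff j, diff k).
rewrite addrACA -opprD -!PoszD !zpow_sub !expgnDr invgM -!mulgA; congr (_ * _)%g.
have c i : commute (t ^+ p) (t ^- i) by apply/commuteV/commuteX2.
have -> : (t ^- q / t ^+ n = t ^- n / t ^+ q)%g by apply/commuteV/commute_sym/commuteV/commuteX2.
by rewrite !mulgA c.
Qed.

Lemma zpowN j : zpow (- j) = (zpow j)^-1%g.
Proof. by apply/esym/mulg1_eq; rewrite -zpowD subrr. Qed.
Lemma zpow_nat n : zpow n%:Z = (t ^+ n)%g. Proof. by []. Qed.
Lemma zpowM j n : (zpow j ^+ n)%g = zpow (j * n%:Z).
Proof.
elim: n => [|n IHn]; first by rewrite mulr0.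
by rewrite expgS IHn -zpowD intS mulrDr mulr1.
Qed.
End IntegerPowers.

Section EdgeCocycles.
Variables (G : groupType) (F : set G) (S : seq G) (t : G).
Hypothesis F_normal : normal_subgroup F.
Hypothesis genS : forall H, subgroup H -> [set` S] `<=` H -> H = setT.
Hypothesis gent : forall x, exists j, F (x * (zpow t j)^-1)%g.
Variables (B : finZmodType) (a : action G B).

(* An additive F-equivariant function on the edges of the Cayley graph of G.  *)
(* It is determined by the edges starting at a power of t, so these functions *)
(* form a closed shift-invariant subgroup of (B ^ S) ^ int.                   *)
Definition edge_cocycle (e : G -> G -> B) :=
  (forall x y z, e x y + e y z = e x z) /\
  (forall g x y, F g -> e (g * x)%g (g * y)%g = a g (e x y)).

Definition shift g (e : G -> G -> B) : G -> G -> B :=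
  fun x y => a g (e (g^-1 * x)%g (g^-1 * y)%g).

Lemma shiftM g h e : shift (g * h)%g e = shift g (shift h e).
Proof. by apply/funext => x; apply/funext => y; rewrite /shift actM invgM !mulgA. Qed.

Lemma shift1 e : shift 1%g e = e.
Proof. by apply/funext => x; apply/funext => y; rewrite /shift act1 invg1 !mul1g. Qed.

Lemma shiftB g e f : shift g (e - f) = shift g e - shift g f.
Proof. by apply/funext => x; apply/funext => y; rewrite [LHS]raddfB. Qed.

Lemma edge_cocycle_shift g e : edge_cocycle e -> edge_cocycle (shift g e).
Proof.
move=> [eD eF]; split=> [x y z|h x y Fh]; first by rewrite /shift -raddfD eD.
have Fhg : F (h ^ g)%g by have [_] := F_normal; apply.
have e1 z : (g^-1 * (h * z) = h ^ g * (g^-1 * z))%g.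
  by rewrite conjgE !mulgA mulgK.
by rewrite /shift !e1 eF // -!actM conjgE !mulgA mulgV mul1g.
Qed.

Lemma edge_cocycle0 : edge_cocycle 0.
Proof. by split=> [x y z|g x y _]; rewrite ?raddf0 // [LHS]addr0. Qed.

Lemma edge_cocycleB e f : edge_cocycle e -> edge_cocycle f -> edge_cocycle (e - f).
Proof.
move=> [eD eF] [fD fF]; split=> [x y z|g x y Fg].
  rewrite -[X in X + _]/(e x y - f x y) -[X in _ + X]/(e y z - f y z).
  by rewrite -[RHS]/(e x z - f x z) -(eD x y z) -(fD x y z); zmod.
by rewrite -[LHS]/(e _ _ - f _ _) eF // fF // -raddfB.
Qed.

Lemma edge_cocycleN e : edge_cocycle e -> edge_cocycle (- e).
Proof. by move=> ce; rewrite -sub0r; apply: edge_cocycleB => //; exact: edge_cocycle0. Qed.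

Lemma edge_cocycleD e f : edge_cocycle e -> edge_cocycle f -> edge_cocycle (e + f).
Proof. by move=> ce cf; rewrite -[f]opprK; apply/edge_cocycleB => //; exact/edge_cocycleN. Qed.

(** Up to the action, the value on the edge from [t^j] to [t^j * S_i]. Bringing the edge back to 1
    makes [shift (zpow t k)] a plain translation of the index [j]. *)
Definition coord (e : G -> G -> B) j (i : 'I_(size S)) : B :=
  shift (zpow t (- j)) e 1%g S`_i.

Lemma coord_shift e j k : coord (shift (zpow t k) e) j = coord e (j - k).
Proof. by apply/funext => i; rewrite /coord -shiftM -zpowD opprB addrC. Qed.

Lemma coordB e f j i : coord (e - f) j i = coord e j i - coord f j i.
Proof. by rewrite /coord shiftB. Qed.
Lemma coord0 j i : coord 0 j i = 0.
Proof. by rewrite /coord /shift raddf0. Qed.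
Lemma coordN e j i : coord (- e) j i = - coord e j i.
Proof. by rewrite -sub0r coordB coord0 sub0r. Qed.
Lemma coordD e f j i : coord (e + f) j i = coord e j i + coord f j i.
Proof. by rewrite -{1}[f]opprK coordB coordN opprK. Qed.

(** The [x] such that every edge from [y] to [y * x] is eventually killed form a subgroup. It
    contains [S], since every [y] is an [F]-translate of a power of [t]. *)
Lemma coord_near0 (I : Type) (U : set_system I) (e : I -> G -> G -> B) : Filter U ->
  (forall i, edge_cocycle (e i)) -> (forall j, \forall i \near U, coord (e i) j = 0) ->
  forall x y, \forall i \near U, e i x y = 0.
Proof.
move=> FU ce e0.
have exx i x : e i x x = 0.
  by have [/(_ x x x)/eqP] := ce i; rewrite -subr_eq0 addrK => /eqP.
have eV i x y : e i y x = - e i x y.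
  by have [/(_ x y x)/eqP] := ce i; rewrite exx addr_eq0 => /eqP ->; rewrite opprK.
pose H : set G := [set x | forall y, \forall i \near U, e i y (y * x)%g = 0].
suff HT : H = setT.
  move=> x y; have : H (x^-1 * y)%g by rewrite HT.
  by move=> /(_ x); rewrite mulVKg.
apply: genS; first split=> /=.
- by move=> y; apply: nearW => i; rewrite mulg1.
- move=> x y xP yP z; apply: filterS2 (xP z) (yP (z * x)%g) => i e1 e2.
  by have [eD _] := ce i; rewrite mulgA -(eD _ (z * x)%g) e1 e2 addr0.
- move=> x xP z; apply: filterS (xP (z * x^-1)%g) => i; rewrite mulgVK => e1.
  by rewrite eV e1 oppr0.
move=> x /= xS y; have [j Fj] := gent y.
have xS' : (index x S < size S)%N by rewrite index_mem.
apply: filterS (e0 j) => i /(congr1 (fun c => a (zpow t j) (c (Ordinal xS')))).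
rewrite /coord /shift /= nth_index // -actM zpowN mulgV act1 invgK mulg1 raddf0 => e1.
have [_ eF] := ce i; rewrite -[y](mulgVK (zpow t j)).
by move: (y * (zpow t j)^-1)%g Fj => g Fg; rewrite -mulgA eF // e1 raddf0.
Qed.

(** Compactness: [B] is finite, so pointwise limits along an ultrafilter exist, and each defining
    identity involves finitely many values. *)
Lemma edge_cocycle_lim (I : Type) (U : set_system I) (e : I -> G -> G -> B) :
  UltraFilter U -> (forall i, edge_cocycle (e i)) ->
  exists2 f, edge_cocycle f & forall x y, U [set i | e i x y = f x y].
Proof.
move=> UU ce.
have [f fP] := boolp.choice (fun xy : G * G =>
  ultra_const UU (fun i => e i xy.1 xy.2)).
exists (fun x y => f (x, y)) => [|x y]; last exact: (fP (x, y)).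
split=> [x y z|g x y Fg].
  have [i [/= <- <- <-]] := ultra_ex3 UU (fP (x, y)) (fP (y, z)) (fP (x, z)).
  by have [eD _] := ce i.
have [i [/= <- <-]] := ultra_ex2 UU (fP (g * x, g * y)%g) (fP (x, y)).
by have [_ eF] := ce i; exact: eF.
Qed.

(** The solution is minus the series of all [h^n.r]. Its partial sums telescope to [r - h^n.r], and
    the error vanishes in the limit. *)
Lemma shift_surj r h : edge_cocycle r ->
  (forall j, \forall n \near \oo, coord (shift (h ^+ n)%g r) j = 0) ->
  exists2 e, edge_cocycle e & shift h e - e = r.
Proof.
move=> cr r0; pose s := fix s n := if n is m.+1 then s m - shift (h ^+ m)%g r else 0.
have cs n : edge_cocycle (s n).
  elim: n => [|n IHn]; first exact: edge_cocycle0.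
  by apply: edge_cocycleB => //; exact: edge_cocycle_shift.
have ds n : shift h (s n) - s n = r - shift (h ^+ n)%g r.
  elim: n => [|n IHn] /=.
    rewrite shift1 !subrr /shift; apply/funext => x; apply/funext => y.
    by rewrite [LHS]subr0 raddf0.
  rewrite shiftB -shiftM -expgS; move: IHn; set u := shift h _; set v := shift (h ^+ n)%g _.
  by move=> /(canRL (subrK _)) ->; zmod.
have [U [UU sU]] := @ultraFilterLemma nat \oo _.
have [e ce eU] := edge_cocycle_lim UU cs.
exists e => //; apply/funext => x; apply/funext => y.
have r0U : U [set n | shift (h ^+ n)%g r x y = 0].
  by apply: sU; apply: (@coord_near0 _ \oo (fun n => shift (h ^+ n)%g r)) => // n;
    exact: edge_cocycle_shift.
have [n [/= e1 e2 e3]] := ultra_ex3 UU (eU x y) (eU (h^-1 * x) (h^-1 * y))%g r0U.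
have /(congr1 (fun f => f x y)) := ds n.
rewrite -[LHS]/(shift h (s n) x y - s n x y) -[RHS]/(r x y - shift (h ^+ n)%g r x y).
by rewrite e3 subr0 e1 {1}/shift e2.
Qed.

Definition vanishes (m n : int) e := forall j, (m <= j)%R -> (j < n)%R -> coord e j = 0.

(** The symbols that can follow [n] consecutive zeros in a point of the shift. *)
Definition follower n (b : 'I_(size S) -> B) :=
  exists e, [/\ edge_cocycle e, vanishes (- n%:Z) 0 e & coord e 0 = b].

(** The follower sets decrease with [n] inside a finite set, hence stabilize. The bound [w] is the
    memory of the shift, which is thus of finite type. *)
Lemma follower_stable : exists w, forall b, follower w b -> forall n, follower n b.
Proof.
apply: contrapT => /forallNP nw.
have nwb w : exists b, follower w b /\ exists n, ~ follower n b.
  by have /existsNP[b /not_implyP[wb /existsNP nb]] := nw w; exists b.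
have [b bP] := boolp.choice nwb.
have [U [UU sU]] := @ultraFilterLemma nat \oo _.
have [c Uc] := ultra_const_fun UU b.
have [w [wc _]] := ultra_ex2 UU Uc Uc.
have [_ [n]] := bP w; rewrite wc; apply.
have : U [set m | n <= m]%N by apply: sU; exact: nbhs_infty_ge.
move=> /(ultra_ex2 UU Uc)[m [/= mc nm]].
have [[e [ce e0 ec]] _] := bP m; rewrite mc in ec.
by exists e; split=> // j nj; apply: e0; lia.
Qed.
(** After [w] zeros, the past of [e] can be replaced by zeros without disturbing its future; [r] is
    the limit of such replacements. *)
Lemma edge_cocycle_split : exists w : nat, forall e, edge_cocycle e -> vanishes (- w%:Z) 0 e ->
  exists r, [/\ edge_cocycle r, forall j, (j < 0)%R -> coord r j = 0 &
                forall j, (0 <= j)%R -> coord (e - r) j = 0].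
Proof.
have [w wP] := follower_stable; exists w => e ce e0.
(* Induction on [m]. The difference [e - u] vanishes on the [w] positions before [m], so its symbol
   at [m] is a follower of [w] zeros, hence of [w + n + m] zeros. Adding a witness of this, shifted
   to [m], extends the agreement by one position and keeps the zeros of [u]. *)
have approx n m : exists u,
    [/\ edge_cocycle u, vanishes (- (w + n)%N%:Z) 0 u & vanishes 0 m%:Z (e - u)].
  elim: m => [|m [u [cu u0 eu]]].
    exists 0; split; first exact: edge_cocycle0.
      by move=> j _ _; apply/funext => i; rewrite coord0.
    by move=> j j0 j1; exfalso; lia.
  have : follower w (coord (e - u) m%:Z).
    exists (shift (zpow t (- m%:Z)) (e - u)); split.
    - exact/edge_cocycle_shift/edge_cocycleB.
    - move=> j j1 j2; rewrite coord_shift opprK.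
      have [jm|mj] : (0 <= j + m%:Z)%R \/ (j + m%:Z < 0)%R by lia.
        by apply: eu => //; lia.
      by apply/funext => i; rewrite coordB e0 ?u0 ?subrr //; lia.
    - by rewrite coord_shift opprK add0r.
  move=> /wP /(_ (w + n + m)%N) [f [cf f0 fm]].
  have fs j : coord (shift (zpow t m%:Z) f) j = coord f (j - m%:Z) by exact: coord_shift.
  exists (u + shift (zpow t m%:Z) f); split.
  - by apply: edge_cocycleD => //; exact: edge_cocycle_shift.
  - move=> j j1 j2; apply/funext => i; rewrite coordD fs u0 // f0 ?addr0 //; lia.
  - move=> j j1 j2; apply/funext => i.
    rewrite opprD addrA coordB fs; have [jm|mj] : (j < m%:Z)%R \/ (m%:Z <= j)%R by lia.
      by rewrite eu // f0 ?subrr //; lia.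
    have -> : j = m%:Z by lia.
    by rewrite subrr fm subrr.
have [u uP] := boolp.choice (fun n => approx n n).
have [U [UU sU]] := @ultraFilterLemma nat \oo _.
have [r cr rU] := edge_cocycle_lim UU (fun n => let: And3 c _ _ := uP n in c).
have coordU j : U [set n | coord (u n) j = coord r j].
  have : \forall n \near U, forall i, coord (u n) j i = coord r j i.
    apply: filter_forall => i; set z := (zpow t (- j))^-1%g.
    apply: filterS (rU (z * 1) (z * S`_i))%g => n /= E.
    by rewrite /coord /shift E.
  by apply: filterS => n /funext.
exists r; split=> // j j0.
  have : U [set n | `|j|%N <= n]%N by apply: sU; exact: nbhs_infty_ge.
  move=> /(ultra_ex2 UU (coordU j))[n [/= <- jn]].
  by have [_ u0 _] := uP n; apply: u0 => //; lia.
have : U [set n | `|j|%N.+1 <= n]%N by apply: sU; exact: nbhs_infty_ge.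
move=> /(ultra_ex2 UU (coordU j))[n [/= E jn]].
have [_ _ u0] := uP n; apply/funext => i; rewrite coordB -E -coordB u0 //; lia.
Qed.

(** By pigeonhole [E m] and [E n] agree on a window of length [w] for some [m < n]. Their difference
    is [t^m.E l] with [l = n - m], and it splits into two halves supported on half-lines, where the
    two series of [shift_surj] converge, one in powers of [t^l], the other in powers of [t^-l]. *)
Lemma edge_cocycle_shift_coboundary (E : nat -> G -> G -> B) :
  (forall n, edge_cocycle (E n)) ->
  (forall m n, E (m + n)%N = E m + shift (t ^+ m)%g (E n)) ->
  exists l e, [/\ (0 < l)%N, edge_cocycle e & E l = shift (t ^+ l)%g e - e].
Proof.
move=> cE ED; have [w wP] := edge_cocycle_split.
have [U [UU sU]] := @ultraFilterLemma nat \oo _.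
have [b Ub] := ultra_const_fun UU
  (fun n (ji : 'I_w * 'I_(size S)) => coord (E n) (- ji.1.+1%:Z) ji.2).
have [m [mb _]] := ultra_ex2 UU Ub Ub.
have /(ultra_ex2 UU Ub)[n [/= nb mn]] : U [set n | m < n]%N.
  by apply: sU; exact: nbhs_infty_ge.
pose l := (n - m)%N; have l0 : (0 < l)%N by rewrite subn_gt0.
have El : E n - E m = shift (t ^+ m)%g (E l) by rewrite -(subnKC (ltnW mn)) ED addrC addKr.
have [r [cr r0 er]] : exists r, [/\ edge_cocycle r, forall j, (j < 0)%R -> coord r j = 0 &
    forall j, (0 <= j)%R -> coord (E n - E m - r) j = 0].
  apply: wP => [|j j1 j2]; first exact: edge_cocycleB.
  apply/funext => i; rewrite coordB; apply/eqP; rewrite subr_eq0; apply/eqP.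
  have jw : (`|j|.-1 < w)%N by lia.
  have := congr1 (fun c => c (Ordinal jw, i)) (etrans nb (esym mb)) => /=.
  by rewrite (_ : - _ = j) //; lia.
have [e1 ce1 e1r] : exists2 e, edge_cocycle e & shift (t ^+ l)%g e - e = r.
  apply: shift_surj => // j; exists (`|j|%N.+1) => // k /= jk.
  rewrite -[t]/(zpow t 1) !zpowM coord_shift r0 //.
  have : (k <= l * k)%N by rewrite leq_pmull.
  lia.
have [e2 ce2 e2r] : exists2 e, edge_cocycle e & shift (t ^- l)%g e - e = E n - E m - r.
  apply: shift_surj => [|j].
    by apply: edge_cocycleB => //; exact: edge_cocycleB.
  exists (`|j|%N.+1) => // k /= jk.
  rewrite -(zpow_nat t l) -zpowN zpowM coord_shift er //.
  have : (k <= l * k)%N by rewrite leq_pmull.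
  lia.
(* This turns [t^-l.e2 - e2] into a coboundary for [t^l]: it equals [t^l.u - u] with
   [u = - t^-l.e2]. *)
pose e := e1 - shift (t ^- l)%g e2.
have Ee : shift (t ^+ l)%g e - e = shift (t ^+ m)%g (E l).
  rewrite -El /e shiftB -shiftM mulgV shift1 -[E n - E m](subrK r) -e2r -e1r.
  zmod.
exists l, (shift (t ^- m)%g e); split=> //.
  by apply: edge_cocycle_shift; apply: edge_cocycleB => //; exact: edge_cocycle_shift.
have c : (t ^+ l * t ^- m = t ^- m * t ^+ l)%g by apply/commuteV/commuteX2.
by rewrite -shiftM c shiftM -shiftB Ee -shiftM mulVg shift1.
Qed.

End EdgeCocycles.

(** * Effaceability for free-by-cyclic groups *)

Section ActionKernel.
Variables (G : groupType) (T : finType) (alpha : G -> T -> T).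
Hypothesis alpha1 : forall b, alpha 1%g b = b.
Hypothesis alphaM : forall g h b, alpha (g * h)%g b = alpha g (alpha h b).

Lemma finite_action_kernel :
  exists N : finNormal G, forall g, finNormal_set N g -> forall b, alpha g b = b.
Proof.
have alphaK g : cancel (alpha g) (alpha g^-1%g) by move=> b; rewrite -alphaM mulVg alpha1.
pose N : set G := [set g | forall b, alpha g b = b].
have sgN : subgroup N.
  split=> [b|x y xN yN b|x xN b]; first exact: alpha1.
    by rewrite alphaM yN xN.
  by rewrite -{1}(xN b) alphaK.
have nN : normal_subgroup N.
  by split=> // x g xN b; rewrite conjgE !alphaM xN alphaK.
suff fN : finite_index N by exists (FinNormal nN fN).
pose Phi (u : {ffun T -> T}) : set G := [set h | forall b, alpha h b = u b].
apply: (@sub_finite_set _ _ (Phi @` setT)); last exact/finite_image/finite_finset.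
move=> _ [g _ <-]; exists [ffun b => alpha g b] => //; apply/seteqP; split=> h /=.
  move=> gh; exists (g^-1 * h)%g; last by rewrite mulgA mulgV mul1g.
  by move=> b; rewrite alphaM gh ffunE alphaK.
by move=> [x xN <-] b; rewrite alphaM xN ffunE.
Qed.

End ActionKernel.

Section CyclicQuotient.
Variables (G : groupType) (F : set G) (t : G).
Hypothesis F_normal : normal_subgroup F.
Hypothesis gent : forall x, exists j, F (x * (zpow t j)^-1)%g.

Local Notation eqF x y := (F (x * y^-1)%g).

Lemma eqFV x y : eqF x y -> eqF x^-1 y^-1.
Proof.
move=> Fxy; have := normal_subJ F_normal y (normal_subV F_normal Fxy).
by rewrite conjgE invgM invgK !mulgA mulVg mul1g.
Qed.

Lemma eqFM x y z w : eqF x y -> eqF z w -> eqF (x * z) (y * w).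
Proof.
move=> Fxy Fzw; have := normal_subM F_normal Fxy (normal_subJ F_normal y^-1 Fzw).
by rewrite conjgE !invgM !invgK !mulgA mulgVK.
Qed.

(** The subgroup is generated by [F] and [t^l]. It is normal because [G / F] is abelian, and
    [1, t, .., t^(l-1)] meet all its cosets. *)
Lemma power_finNormal l : (0 < l)%N ->
  exists N : finNormal G, forall g, finNormal_set N g <-> exists j, eqF g (zpow t (j * l%:Z)).
Proof.
move=> l0; pose N : set G := [set g | exists j, eqF g (zpow t (j * l%:Z))].
have sgN : subgroup N.
  split=> [|x y [j xj] [k yk]|x [j xj]].
  - by exists 0; rewrite mul0r mul1g invg1; exact: normal_sub1.
  - by exists (j + k); rewrite mulrDl zpowD; exact: eqFM.
  - by exists (- j); rewrite mulNr zpowN; exact: eqFV.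
have nN : normal_subgroup N.
  split=> // x g [j xj]; exists j; have [i gi] := gent g.
  have := eqFM (eqFV gi) (eqFM xj gi).
  by rewrite -zpowN -!zpowD addrCA addNr addr0.
suff fN : finite_index N by exists (FinNormal nN fN).
apply: (@sub_finite_set _ _ ((fun i : 'I_l => lcoset N (zpow t i)) @` setT)); last first.
  exact/finite_image/finite_finset.
move=> _ [g _ <-]; have [i gi] := gent g.
have il : (`|i %% l|%Z%N < l)%N by lia.
exists (Ordinal il) => //; apply/esym/lcosetP => //.
have Fr x : eqF x x by rewrite mulgV; exact: normal_sub1.
exists (- (i %/ l)%Z); rewrite (_ : - (i %/ l)%Z * l%:Z = - i + `|(i %% l)%Z|%N); last by lia.
by rewrite zpowD zpowN; apply: eqFM => //; exact: eqFV.
Qed.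

Lemma zpow_mem (H : set G) l j : subgroup H -> H (t ^+ l)%g -> H (zpow t (j * l%:Z)).
Proof.
move=> [H1 HM HV] Hl; have Hn (n : nat) : H (zpow t (n%:Z * l%:Z)).
  rewrite mulrC -zpowM zpow_nat; elim: n => [//|n IHn].
  by rewrite expgS; exact: HM.
case: j => n //.
by rewrite NegzE mulNr zpowN; exact: HV.
Qed.

Hypothesis t_infinite : forall n, (0 < n)%N -> ~ F (t ^+ n)%g.

Lemma height_function : exists rho : G -> int,
  (forall g x, F g -> rho (g * x)%g = rho x) /\ (forall x, rho (t * x)%g = rho x + 1).
Proof.
have [rho rhoP] := boolp.choice gent; exists rho.
have uniq i j x : eqF x (zpow t i) -> eqF x (zpow t j) -> i = j.
  have F0 k : F (zpow t k) -> k = 0.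
    case: k => [[//|n]|n] Fn; first by case: (@t_infinite n.+1).
    by case: (@t_infinite n.+1) => //; have := normal_subV F_normal Fn; rewrite invgK.
  move=> xi xj; suff : j - i = 0 by move/eqP; rewrite subr_eq0 => /eqP.
  apply: F0; have := normal_subM F_normal (normal_subV F_normal xj) xi.
  rewrite invgM invgK -mulgA mulKg.
  by rewrite -zpowN -zpowD.
split=> [g x Fg|x].
  apply: (uniq _ _ (g * x)%g) => //.
  by rewrite -mulgA; apply: normal_subM.
apply: (uniq _ _ (t * x)%g) => //; rewrite addrC zpowD.
by apply: eqFM => //; rewrite mulgV; exact: normal_sub1.
Qed.

Variables (B : zmodType) (a : action G B).

Lemma equivariant_translation g f :
  equivariant a F f -> equivariant a F (translation a g f).
Proof.
move=> /equivariantP ef; apply/equivariantP => h Fh.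
by rewrite -actM conjgC actM ef //; exact: normal_subJ.
Qed.

Lemma equivariantD f h :
  equivariant a F f -> equivariant a F h -> equivariant a F (f + h).
Proof. by move=> ef eh g s Fg; rewrite -[LHS]/(f _ + h _) ef // eh // -raddfD. Qed.

(* m is computed by iterating the equation away from the slice of height 0.   *)
Lemma translation_sub_surj k : equivariant a F k -> k [::] = 0 ->
  exists m, [/\ equivariant a F m, translation a t m - m = k & m [::] = 0].
Proof.
move=> ek k0; have [rho [rhoF rhot]] := height_function.
(* Unrolling [t.m = m + k] from [m = 0] at height 0: [P n] is [k + t.k + .. + t^(n-1).k] and [Q n]
   is [t^-1.k + .. + t^-n.k]. At height [n >= 0] the solution is [- P n], at height [- n < 0] it is
   [Q n]. *)
pose P := fix P n : seq G -> B := if n is n'.+1 then k + translation a t (P n') else 0.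
pose Q := fix Q n : seq G -> B := if n is n'.+1 then translation a t^-1%g (Q n' + k) else 0.
have eP n : equivariant a F (P n).
  elim: n => [|n IHn]; first by move=> g s _; rewrite raddf0.
  by apply: equivariantD => //; exact: equivariant_translation.
have eQ n : equivariant a F (Q n).
  elim: n => [|n IHn]; first by move=> g s _; rewrite raddf0.
  by apply: equivariant_translation; exact: equivariantD.
pose m s := if s is x :: _ then match rho x with Posz n => - P n s | Negz n => Q n.+1 s end else 0.
exists m; split=> //.
  move=> g [|x s] Fg; first by rewrite raddf0.
  rewrite /m /= rhoF //; case: (rho x) => n; rewrite -map_cons; last exact: (eQ n.+1 g (x :: s) Fg).
  by rewrite eP //; exact/esym/raddfN.
apply/funext => -[|x s]; first by rewrite -[LHS]/(a t 0 - 0) raddf0 subr0 k0.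
rewrite -[LHS]/(translation a t m (x :: s) - m (x :: s)) translationE /m /=.
have := rhot (t^-1 * x)%g; rewrite mulVKg => ->.
have QE n : a t (Q n.+1 [seq (t^-1 * x)%g | x <- x :: s]) = Q n (x :: s) + k (x :: s).
  by rewrite -translationE -actM mulgV act1.
case: (rho _) => n.
  rewrite -PoszD addn1 -map_cons; set s' := map _ _.
  suff : a t (- P n s') + (k (x :: s) + a t (P n s')) = k (x :: s) by rewrite opprK.
  by rewrite raddfN /=; zmod.
rewrite -map_cons -[a t _]/(a t (Q n.+1 _)) QE; case: n => [|n].
  rewrite (_ : Negz 0 + 1 = Posz 0) //.
  by have [-> ->] : Q 0%N (x :: s) = 0 /\ P 0%N (x :: s) = 0 by []; zmod.
rewrite (_ : Negz n.+1 + 1 = Negz n); last by lia.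
suff : Q n.+1 (x :: s) + k (x :: s) - Q n.+1 (x :: s) = k (x :: s) by [].
by zmod.
Qed.

End CyclicQuotient.

Lemma equivariant_subgroup (G : groupType) (B : zmodType) (a : action G B) (f : seq G -> B) :
  subgroup [set g | translation a g f = f].
Proof.
split=> /= [|x y ex ey|x ex]; first exact: (act1 (translation a)).
  by rewrite translateM ey ex.
by rewrite -{1}ex -translateM mulVg translate1.
Qed.

Lemma equivariant_truncate (G : groupType) (B : zmodType) (a : action G B) H n f :
  equivariant a H f -> equivariant a H (fun s => if size s == n then f s else 0).
Proof.
by move=> ef g s Hg; rewrite size_map; case: ifP => _; [exact: ef|rewrite raddf0].
Qed.

(** A cochain on [n.+2] vertices has degree [n.+1], so degree 0 is excluded. An [N]-equivariant
    primitive on all of [G] witnesses that the restriction to [N] is trivial, since [G] is a free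
    [N]-set. *)
Definition effaceable (G : groupType) :=
  forall (B : finZmodType) (a : action G B) n f,
  equivariant a setT f -> bd f = 0 -> supported n.+2 f ->
  exists (N : finNormal G) h, [/\ equivariant a N h, bd h = f & supported n.+1 h].

Lemma free_by_cyclic_effaceable (G : groupType) :
  finitely_generated G -> free_by_cyclic G -> effaceable G.
Proof.
move=> [S genS] [F [nF [_ freeF] [t gent0]]] B a n f ef df fn.
case: n => [|n] in fn *.
  (* Degree 1: [D] is a derivation, so [b |-> a g b + D g] is an affine action on the finite set
     [B]. On its kernel, evaluation at 0 gives [D g = 0], and then [a g] is the identity. *)
  pose D x := f [:: 1%g; x].
  have dfE x y z : f [:: y; z] = f [:: x; z] - f [:: x; y].
    apply/eqP; rewrite -subr_eq0; apply/eqP; rewrite -[RHS](congr1 (@^~ [:: x; y; z]) df) /=.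
    by zmod.
  have DM g x : D (g * x)%g = D g + a g (D x).
    by rewrite -(ef g [:: 1%g; x]) //= mulg1 (dfE 1%g); rewrite /D; zmod.
  have [|g h b|N NP] := @finite_action_kernel G B (fun g b => a g b + D g).
  - by move=> b; rewrite act1 /D (dfE 1%g) subrr addr0.
  - by rewrite actM DM actD; zmod.
  have ND g : finNormal_set N g -> D g = 0.
    by move=> /NP/(_ 0); rewrite raddf0 add0r.
  have Na g b : finNormal_set N g -> a g b = b.
    by move=> Ng; have := NP g Ng b; rewrite ND // addr0.
  exists N, (fun s => if s is [:: x] then D x else 0); split=> [g [|x [|y s]]|| [|x [|y s]]] //=.
  - by rewrite raddf0.
  - by move=> Ng; rewrite DM ND // add0r.
  - by rewrite raddf0.
  apply/funext => -[|x [|y [|z s]]].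
  - by rewrite fn.
  - by rewrite fn //= subrr.
  - by rewrite /= subr0 /D (dfE 1%g).
  - by rewrite fn //= (@bd0 _ _ s) subr0 !subrr.
have gent x : exists j, F (x * (zpow t j)^-1)%g.
  have Fconj y : lcoset F x = lcoset F y -> F (x * y^-1)%g.
    move=> /lcosetP-/(_ (proj1 nF)) /(normal_subV nF) /(normal_subJ nF y^-1).
    by rewrite conjgE !invgM !invgK mulgA mulgA mulgV mul1g.
  have [k [] /Fconj Fx] := gent0 x; first by exists k%:Z.
  by exists (- k%:Z); rewrite zpowN.
have [h0 [eh0 dh0 h0z]] : exists h,
    [/\ equivariant a F h, bd h = f & forall s, (size s <= 1)%N -> h s = 0].
  by apply: free_coboundary => // [g s _|s s2]; [exact: ef|apply: fn; case: eqP s2 => // ->].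
pose h s := if size s == n.+2 then h0 s else 0.
have eh : equivariant a F h by exact: equivariant_truncate.
have dh : bd h = f by exact: bd_truncate.
have hn : supported n.+2 h by move=> s; rewrite /h => /negPf ->.
have efT g : translation a g f = f by apply: (iffLR (equivariantP _ _ _)) ef g I.
clearbody h.
(* The stabilizer of [h'] is a subgroup, so invariance under [F] and [t^l] gives invariance under
   the finite-index subgroup they generate. *)
suff [l [h' [l0 eh' th' dh']]] : exists l h', [/\ (0 < l)%N, equivariant a F h',
    translation a (t ^+ l)%g h' = h' & bd h' = f].
  have [N NP] := power_finNormal nF gent l0.
  exists N, (fun s => if size s == n.+2 then h' s else 0); split; last first.
  - by move=> s /negPf ->.
  - exact: bd_truncate.
  apply: equivariant_truncate; apply/equivariantP => g /NP[j gj].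
  have sgH := equivariant_subgroup a h'; have [_ HM _] := sgH.
  rewrite -[g](mulgVK (zpow t (j * l%:Z))); apply: HM; last exact: zpow_mem.
  by apply: (iffLR (equivariantP _ _ _)) eh' _ gj.
(* If [G / F] is finite, some [t^l] with [l > 0] lies in [F] and [h] already works. *)
have [[l [l0 Fl]]|tinf] := pselect (exists l, (0 < l)%N /\ F (t ^+ l)%g).
  by exists l, h; split=> //; apply: (iffLR (equivariantP _ _ _)) eh _ Fl.
have {}tinf l : (0 < l)%N -> ~ F (t ^+ l)%g by move=> l0 Fl; apply: tinf; exists l.
have eT g : equivariant a F (translation a g h - h).
  by apply: equivariantB => //; exact: equivariant_translation.
have dT g : bd (translation a g h - h) = 0.
  by rewrite bd_funB bd_translation dh efT subrr.
(* When [f] has degree at least 3, the obstruction has degree at least 2 and [free_coboundary]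
   applies to it as well. In degree 2 it is a family of edge cocycles. *)
case: n => [|n] in fn hn dh0 h0z eh0 *; last first.
  have [k [ek dk kz]] : exists k, [/\ equivariant a F k, bd k = translation a t h - h &
      forall s, (size s <= 1)%N -> k s = 0].
    apply: free_coboundary => // s s2; rewrite -[LHS]/(translation a t h s - h s).
    have hs r : size r = size s -> h r = 0 by move=> rs; apply: hn; apply/eqP; lia.
    by rewrite translationE !hs ?size_map // raddf0 subrr.
  have [m [em tm _]] := translation_sub_surj nF gent tinf ek (kz [::] isT).
  exists 1%N, (h - bd m); split=> //.
  - by apply: equivariantB => //; exact: equivariant_bd.
  - apply/eqP; rewrite -subr_eq0 expg1; apply/eqP.
    have -> : translation a t (h - bd m) = translation a t h - bd (translation a t m).
      by rewrite bd_translation; exact: raddfB.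
    have -> : translation a t h - bd (translation a t m) - (h - bd m) =
      translation a t h - h - (bd (translation a t m) - bd m) by zmod.
    by rewrite -bd_funB tm dk subrr.
  - rewrite bd_funB dh; apply/funext => s.
    by rewrite -[LHS]/(f s - bd (bd m) s) bd_bd subr0.
pose E l x y := (translation a (t ^+ l)%g h - h) [:: x; y].
have cE l : edge_cocycle F a (E l).
  split=> [x y z|g x y Fg]; last exact: (eT _ g [:: x; y]).
  have := congr1 (@^~ [:: x; y; z]) (dT (t ^+ l)%g); rewrite /= -/(E l x y) -/(E l x z) -/(E l y z).
  rewrite -[RHS]/0 => e0; apply/eqP; rewrite -subr_eq0 -e0; apply/eqP; zmod.
have [|l [e [l0 [eD eF] El]]] := edge_cocycle_shift_coboundary nF genS gent cE.
  move=> l m; apply/funext => x; apply/funext => y.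
  rewrite -[RHS]/(E l x y + a (t ^+ l)%g (E m _ _)) /E expgnDr actM.
  set u := translation a (t ^+ m)%g h; set v := translation a (t ^+ l)%g.
  have -> : a (t ^+ l)%g ((u - h) [:: ((t ^+ l)^-1 * x)%g; ((t ^+ l)^-1 * y)%g]) =
    v (u - h) [:: x; y] by [].
  rewrite -[RHS]/((v h - h + v (u - h)) [:: x; y]); congr (_ [:: x; y]).
  by rewrite /v raddfB; zmod.
pose e' s := if s is [:: x; y] then e x y else 0.
exists l, (h - e'); split=> //.
- apply: equivariantB => // g [|x [|y [|z s]]] Fg /=; rewrite ?raddf0 //.
  exact: eF.
- apply/eqP; rewrite -subr_eq0; apply/eqP/funext => s.
  have -> : translation a (t ^+ l)%g (h - e') =
      translation a (t ^+ l)%g h - translation a (t ^+ l)%g e'.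
    exact: raddfB.
  have -> : translation a (t ^+ l)%g h - translation a (t ^+ l)%g e' - (h - e') =
    translation a (t ^+ l)%g h - h - (translation a (t ^+ l)%g e' - e') by zmod.
  have se : supported 2 e' by move=> [|x [|y []]].
  have st u : supported 2 u -> supported 2 (translation a (t ^+ l)%g u).
    by move=> su r r2; rewrite translationE su ?raddf0 // size_map.
  rewrite -[LHS]/(translation a (t ^+ l)%g h s - h s - (translation a (t ^+ l)%g e' s - e' s)).
  have [s2|s2] := eqVneq (size s) 2; last by rewrite !st ?hn ?se ?subrr.
  case: s s2 => [|x [|y []]] // _.
  by apply/eqP; rewrite subr_eq0; apply/eqP; exact: (congr1 (fun f => f x y) El).
rewrite bd_funB dh; apply/funext => s.
rewrite -[LHS]/(f s - bd e' s) [X in _ - X](_ : _ = 0) ?subr0 //.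
have [s3|s3] := eqVneq (size s) 3; last first.
  by apply: (@bd_supported _ _ 2) => // r; case: r => [|x [|y []]].
case: s s3 => [|x [|y [|z []]]] //= _.
by rewrite -(eD x y z); zmod.
Qed.

(** * The double complex of partially uniform cochains *)

Section CosetUniform.
Variable G : groupType.

Definition same_cosets (N : set G) (s r : seq G) :=
  [seq lcoset N x | x <- s] = [seq lcoset N x | x <- r].

Lemma lcoset_sub (N N' : set G) g h : subgroup N -> subgroup N' -> N `<=` N' ->
  lcoset N g = lcoset N h -> lcoset N' g = lcoset N' h.
Proof. by move=> sN sN' NN' /lcosetP-/(_ sN)/NN' /lcosetP; exact. Qed.

Lemma lcosetM (N : set G) k g h : subgroup N ->
  lcoset N g = lcoset N h -> lcoset N (k * g)%g = lcoset N (k * h)%g.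
Proof. by move=> sN /lcosetP-/(_ sN) gh; apply/lcosetP => //; rewrite invgM -mulgA mulKg. Qed.

Lemma same_cosets_size N s r : same_cosets N s r -> size s = size r.
Proof. by move=> /(congr1 size); rewrite !size_map. Qed.

Lemma same_cosets_sub N N' s r : subgroup N -> subgroup N' -> N `<=` N' ->
  same_cosets N s r -> same_cosets N' s r.
Proof.
move=> sN sN' NN'; rewrite /same_cosets; elim: s r => [|x s IHs] [|y r] //= [xy sr].
by rewrite (lcoset_sub _ _ NN' xy) // (IHs r).
Qed.

Lemma same_cosetsM N g s r : subgroup N -> same_cosets N s r ->
  same_cosets N [seq (g * x)%g | x <- s] [seq (g * x)%g | x <- r].
Proof.
move=> sN; rewrite /same_cosets; elim: s r => [|x s IHs] [|y r] //= [xy sr].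
by rewrite (lcosetM g sN xy) // (IHs r).
Qed.

Lemma finNormal_subgroup (N : finNormal G) : subgroup N.
Proof. by have [] := finNormal_normal N. Qed.

Lemma finNormalI (N N' : finNormal G) :
  exists K : finNormal G, finNormal_set K = N `&` N'.
Proof.
have [[N1 NM NV] NJ] := finNormal_normal N; have [[N1' NM' NV'] NJ'] := finNormal_normal N'.
have sI : subgroup (N `&` N').
  by split=> [//|x y [? ?] [? ?]|x [? ?]]; split; auto.
have nI : normal_subgroup (N `&` N') by split=> // x g [? ?]; split; auto.
suff fI : finite_index (N `&` N') by exists (FinNormal nI fI).
have := finite_setX (finNormal_index N) (finNormal_index N').
move=> /(finite_image (fun AB => AB.1 `&` AB.2)); apply: sub_finite_set => _ [g _ <-].
exists (lcoset N g, lcoset N' g); first by split; exists g.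
apply/seteqP; split=> h /=; last by move=> [x [Nx Nx'] <-]; split; exists x.
by move=> [[x Nx <-] [y Ny /mulgI yx]]; exists x => //; split=> //; rewrite -yx.
Qed.

Lemma coset_index (N : finNormal G) : exists m (cl : G -> 'I_m) (rep : 'I_m -> G),
  [/\ forall g h, lcoset N g = lcoset N h -> cl g = cl h,
      forall i, cl (rep i) = i & forall g, lcoset N (rep (cl g)) = lcoset N g].
Proof.
have [s0 s0P] := iffLR (finite_seqP _) (finNormal_index N).
pose s := undup s0; have sP g : lcoset N g \in s.
  by rewrite mem_undup; suff : range (lcoset N) (lcoset N g) by rewrite s0P.
have cl_lt g : (index (lcoset N g) s < size s)%N by rewrite index_mem.
have /boolp.choice[rep repP] (i : 'I_(size s)) : exists g, lcoset N g = nth set0 s i.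
  have : range (lcoset N) (nth set0 s i).
    by rewrite s0P /= -(mem_undup s0) mem_nth.
  by move=> [g _ <-]; exists g.
exists (size s), (fun g => Ordinal (cl_lt g)), rep; split=> [g h e|i|g].
- by apply: val_inj; rewrite /= e.
- by apply: val_inj; rewrite /= repP index_uniq // undup_uniq.
- by rewrite repP nth_index.
Qed.

End CosetUniform.

Definition uniform (G : groupType) (N : set G) (U : Type) (u : seq G -> U) :=
  forall s r, same_cosets N s r -> u s = u r.

HB.instance Definition _ (K : finType) (M : finZmodType) := Finite.on {ffun K -> M}.

Section UniformModule.
Variables (G : groupType) (M : finZmodType) (a : action G M) (N : finNormal G) (q : nat).

(* B is the module of functions (G / N)^q -> M, identified by dec with the    *)
(* uniform functions supported on sequences of size q.                        *)
Lemma uniform_module : exists (B : finZmodType) (b : action G B)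
    (enc : (seq G -> M) -> B) (dec : B -> seq G -> M),
  [/\ {morph enc : u v / u - v}, {morph dec : u v / u - v},
      forall g v, b g v = enc (translation a g (dec v)),
      forall v, uniform N (dec v) /\ supported q (dec v) &
      forall u, uniform N u -> supported q u -> dec (enc u) = u].
Proof.
have [m [cl [rep [clP repK repP]]]] := coset_index N.
pose K := {ffun 'I_q -> 'I_m}.
pose B : finZmodType := {ffun K -> M}.
pose lst (k : K) := [seq rep (k i) | i <- enum 'I_q].
have size_lst k : size (lst k) = q by rewrite size_map size_enum_ord.
have nth_lst k (i : 'I_q) : nth 1%g (lst k) i = rep (k i).
  by rewrite (nth_map i) ?size_enum_ord // nth_ord_enum.
pose enc (u : seq G -> M) : B := [ffun k => u (lst k)].
pose idx (s : seq G) : K := [ffun i : 'I_q => cl (nth 1%g s i)].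
pose dec (v : B) s := if size s == q then v (idx s) else 0.
have idxK k : idx (lst k) = k.
  by apply/ffunP => i; rewrite ffunE nth_lst repK.
have decK v : enc (dec v) = v.
  by apply/ffunP => k; rewrite ffunE /dec size_lst eqxx idxK.
have encB : {morph enc : u v / u - v} by move=> u v; apply/ffunP => k; rewrite !ffunE.
have decB : {morph dec : u v / u - v}.
  move=> u v; apply/funext => s; rewrite -[RHS]/(dec u s - dec v s) /dec.
  by case: ifP => _; rewrite ?ffunE ?subrr.
have dec_uniform v : uniform N (dec v).
  move=> s r sr; rewrite /dec (same_cosets_size sr); case: eqP => // rq.
  congr (v _); apply/ffunP => i; rewrite !ffunE; apply: clP.
  have sq : size s = q by rewrite (same_cosets_size sr).
  have := congr1 (fun l => nth set0 l i) sr.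
  by rewrite !(nth_map 1%g) ?sq ?rq.
have dec_supported v : supported q (dec v) by move=> s; rewrite /dec => /negPf ->.
have encK u : uniform N u -> supported q u -> dec (enc u) = u.
  move=> uu su; apply/funext => s; rewrite /dec; case: eqP => [sq|/eqP/su //].
  rewrite ffunE; apply: uu; apply: (@eq_from_nth _ set0).
    by rewrite (size_map _ (lst _)) size_lst size_map sq.
  rewrite (size_map _ (lst _)) size_lst => i iq.
  rewrite !(nth_map 1%g) ?size_lst ?sq // -[i]/(nat_of_ord (Ordinal iq)) nth_lst.
  by rewrite ffunE repP.
have trK g v : dec (enc (translation a g (dec v))) = translation a g (dec v).
  apply: encK => [s r sr|s sq]; rewrite !translationE.
    by congr (a g _); apply/dec_uniform/same_cosetsM => //; exact: finNormal_subgroup.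
  by rewrite dec_supported ?raddf0 // size_map.
pose b g v := enc (translation a g (dec v)).
have b1 v : b 1%g v = v by rewrite /b act1 decK.
have bM g h v : b (g * h)%g v = b g (b h v) by rewrite /b trK actM.
have bD g v w : b g (v + w) = b g v + b g w.
  have e : forall x y : B, b g (x - y) = b g x - b g y.
    by move=> x y; rewrite /b decB -encB; congr (enc _); exact: raddfB.
  by apply/eqP; rewrite -subr_eq -e addrK.
by exists B, (Action b1 bM bD), enc, dec; split.
Qed.

End UniformModule.

Section Bicochains.
Variables (G : groupType) (M : finZmodType) (a : action G M).
Implicit Types (f g k : seq G -> seq G -> M).

(* The double complex of G-equivariant functions of simplices x and y that    *)
(* are uniformly continuous in y; rows compare with all cochains of G,        *)
(* columns with the continuous ones.                                          *)
Definition bicochain p q f :=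
  [/\ forall x y, (size x != p.+1) || (size y != q.+1) -> f x y = 0,
      forall h x y, f [seq (h * z)%g | z <- x] [seq (h * z)%g | z <- y] = a h (f x y) &
      exists N : finNormal G, forall x, uniform N (f x)].

Definition dy f : seq G -> seq G -> M := fun x => bd (f x).

Lemma bd_dy f : bd (dy f) = dy (bd f).
Proof.
apply/funext => x; apply/funext => y; rewrite /dy -(@bd_morph _ _ _ (@bd G M)) //.
exact: bd_funB.
Qed.

Lemma dyB f g : dy (f - g) = dy f - dy g.
Proof. by apply/funext => x; rewrite [LHS]bd_funB. Qed.

Lemma dy_dy f : dy (dy f) = 0.
Proof. by apply/funext => x; apply/funext => y; exact: bd_bd. Qed.

Lemma bd_bd0 (T : Type) (B : zmodType) (f : seq T -> B) : bd (bd f) = 0.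
Proof. by apply/funext => x; exact: bd_bd. Qed.

Lemma bicochainB p q f g : bicochain p q f -> bicochain p q g -> bicochain p q (f - g).
Proof.
move=> [fs fe [N fN]] [gs ge [N' gN]]; have E x y : (f - g) x y = f x y - g x y by [].
split=> [x y xy|h x y|].
- by rewrite E fs // gs // subrr.
- by rewrite !E fe ge -raddfB.
have [K KE] := finNormalI N N'; exists K => x s r sr.
have [KN KN'] : K `<=` N /\ K `<=` N' by rewrite KE; split=> z [].
have sg := @finNormal_subgroup G.
by rewrite !E (fN x s r) ?(gN x s r) //;
  [exact: same_cosets_sub KN' sr|exact: same_cosets_sub KN sr].
Qed.

Lemma bicochain0 p q : bicochain p q 0.
Proof.
split=> //; first by move=> h x y; rewrite raddf0.
by have [//|//|N _] := @finite_action_kernel G M (fun=> id); exists N.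
Qed.

Lemma bicochain_bd p q f : bicochain p q f -> bicochain p.+1 q (bd f).
Proof.
move=> [fs fe [N fN]]; split=> [x y xy|h x y|].
- rewrite bd_eval; case/orP: xy => [xp|yq].
    by apply: (@bd_supported _ _ p.+1) => // r rp; rewrite fs // rp.
  rewrite -[RHS](@bd0 G M x); congr (bd _ x); apply/funext => r.
  by rewrite fs // yq orbT.
- rewrite !bd_eval bd_map -bd_raddf; congr (bd _ x); apply/funext => r; exact: fe.
exists N => x s r sr; rewrite !bd_eval; congr (bd _ x); apply/funext => z; exact: fN.
Qed.

Lemma bicochain_dy p q f : bicochain p q f -> bicochain p q.+1 (dy f).
Proof.
move=> [fs fe [N fN]]; split=> [x y xy|h x y|].
- case/orP: xy => [xp|yq].
    rewrite -[RHS](@bd0 G M y); congr (bd _ y); apply/funext => r.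
    by rewrite fs // xp.
  by apply: (@bd_supported _ _ q.+1) => // r rp; rewrite fs // rp orbT.
- rewrite /dy bd_map -bd_raddf; congr (bd _ y); apply/funext => r; exact: fe.
exists N => x s r sr; apply: (bd_congr _ sr); exact: fN.
Qed.

(** The first vertex of [x] serves as cone point for [y]; this choice is equivariant and leaves
    uniformity in [y] intact. *)
Lemma dy_exact p q f : bicochain p q.+1 f -> dy f = 0 ->
  exists2 g, bicochain p q g & dy g = f.
Proof.
move=> [fs fe [N fN]] df; exists (fun x y => if x is x0 :: _ then f x (x0 :: y) else 0).
  split=> [[|x0 x] y xy|h [|x0 x] y|] //=; first exact: fs.
  - by rewrite raddf0.
  - by rewrite -fe.
  by exists N => -[|x0 x] s r sr //; apply: fN; rewrite /same_cosets /= sr.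
apply/funext => -[|x0 x]; apply/funext => y; first by rewrite /dy bd0 fs.
have := congr1 (fun g => g (x0 :: x) (x0 :: y)) df.
by rewrite /dy /= => /eqP; rewrite subr_eq0 => /eqP.
Qed.

Hypothesis effG : effaceable G.

(** Seen as a function of [x], [f] is a cocycle of degree [p.+1] with values in the finite module of
    uniform functions of [y]. Effaceability gives a primitive equivariant under some [N'] only. Full
    equivariance is recovered by letting the coset of the first vertex of [y] modulo [N'] choose a
    translate. *)
Lemma bd_exact p q f : bicochain p.+1 q f -> bd f = 0 ->
  exists2 g, bicochain p q g & bd g = f.
Proof.
move=> [fs fe [N fN]] df.
have [B [b [enc [dec [encB decB bE decP encK]]]]] := uniform_module a N q.+1.
have enc0 : enc 0 = 0 by rewrite -(subrr 0) encB subrr.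
have dec0 : dec 0 = 0 by rewrite -(subrr 0) decB subrr.
have fK x : dec (enc (f x)) = f x.
  by apply: encK => [|y yq]; [exact: fN|rewrite fs // yq orbT].
have [|||N' [h [eh dh hs]]] := effG (a := b) (f := fun x => enc (f x)) (n := p).
- move=> g s _; rewrite bE fK; congr enc; apply/funext => y.
  by rewrite translationE -fe map_mulgVK.
- by apply/funext => x; rewrite bd_morph // df enc0.
- by move=> x xp; rewrite -enc0; congr enc; apply/funext => y; rewrite fs // xp.
pose k x := dec (h x).
have dk : bd k = f by apply/funext => x; rewrite /k bd_morph // dh fK.
have kN' e x y : finNormal_set N' e ->
    k [seq (e * z)%g | z <- x] [seq (e * z)%g | z <- y] = a e (k x y).
  move=> N'e; have [ku ks] := decP (h x); rewrite /k eh // bE encK.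
  - by rewrite translationE map_mulgK.
  - move=> s r sr; rewrite !translationE; congr (a e _).
    by apply/ku/same_cosetsM => //; exact: finNormal_subgroup.
  - by move=> s sq; rewrite translationE ks ?raddf0 // size_map.
have k0 x : k x [::] = 0 by have [_] := decP (h x); apply.
have [m [cl [rep [clP repK repP]]]] := coset_index N'.
(* [N']-equivariance makes the translate by [c y] depend only on the coset of the first vertex of
   [y]. An empty [y] receives the default vertex 1, harmlessly in view of [k0]. *)
pose c y := rep (cl (head 1%g y)).
pose g x y := a (c y) (k [seq ((c y)^-1 * z)%g | z <- x] [seq ((c y)^-1 * z)%g | z <- y]).
exists g; last first.
  apply/funext => x; apply/funext => y; rewrite bd_eval /g bd_raddf.
  have -> e z : bd (fun r => k [seq (e * u)%g | u <- r] z) x = bd k [seq (e * u)%g | u <- x] z.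
    by rewrite bd_map bd_eval.
  have E := fe (c y) [seq ((c y)^-1 * u)%g | u <- x] [seq ((c y)^-1 * u)%g | u <- y].
  by rewrite !map_mulgVK in E; rewrite dk E.
split=> [x y xy|e x y|].
- rewrite /g; case/orP: xy => [xp|yq]; last first.
    by have [_ ks] := decP (h [seq ((c y)^-1 * z)%g | z <- x]); rewrite /k ks ?raddf0 // size_map.
  by rewrite /k hs ?size_map // dec0 raddf0.
- case: y => [|y0 y]; first by rewrite /g /= !k0 !raddf0.
  rewrite /g; set ce := c _; set c0 := c (y0 :: y).
  have ceE : lcoset N' ce = lcoset N' (e * c0)%g.
    by rewrite /ce /c repP /=; apply: lcosetM; [exact: finNormal_subgroup|rewrite repP].
  move/lcosetP: ceE => /(_ (finNormal_subgroup _)); set nu := (ce^-1 * (e * c0))%g => N'nu.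
  have E s : [seq (ce^-1 * z)%g | z <- [seq (e * z)%g | z <- s]] =
             [seq (nu * z)%g | z <- [seq (c0^-1 * z)%g | z <- s]].
    rewrite -!map_comp; apply: eq_map => z /=.
    by rewrite /nu !mulgA mulgK.
  by rewrite !E kN' // -!actM /nu mulVKg.
have [K KE] := finNormalI N N'.
have [KN KN'] : K `<=` N /\ K `<=` N' by rewrite KE; split=> z [].
have sg := @finNormal_subgroup G.
exists K => x s r sr; have srN := same_cosets_sub (sg _) (sg _) KN sr.
have srN' := same_cosets_sub (sg _) (sg _) KN' sr.
have csr : c s = c r.
  rewrite /c; congr rep; apply: clP; case: s r srN' {sr srN} => [|? ?] [|? ?] //= [] //.
rewrite /g csr; congr (a _ _); have [ku _] := decP (h [seq ((c r)^-1 * z)%g | z <- x]).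
exact/ku/same_cosetsM.
Qed.

Fixpoint aw p f z : M :=
  if z is x :: s then
    if p is p'.+1 then aw p' (fun r => f (x :: r)) s else f [:: x] z
  else 0.

Lemma awB p f g z : aw p (f - g) z = aw p f z - aw p g z.
Proof.
elim: p z f g => [|p IHp] [|x s] f g //=; rewrite ?subrr //.
exact: (IHp s (fun r => f (x :: r)) (fun r => g (x :: r))).
Qed.

(* The Alexander-Whitney map (aw p f) z = f (z_0 .. z_p) (z_p .. z_n) is a     *)
(* chain map from the total complex to the cochains of G.                      *)
Lemma aw_bd p f : (forall x, f x [::] = 0) ->
  bd (aw p f) = fun z => aw p.+1 (bd f) z + aw p (dy f) z *~ (-1) ^+ p.
Proof.
move=> f0; apply/funext; elim: p f f0 => [|p IHp] f f0 [|x s] /=.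
- by rewrite mul0rz addr0.
- rewrite mulr1z; case: s => [|y s] /=.
    by rewrite /dy /= f0; zmod.
  have E u v r : (u - v : seq G -> M) r = u r - v r by [].
  rewrite !E /dy /=.
  by rewrite -[(0 : seq G -> M) _]/(0 : M); zmod.
- by rewrite mul0rz addr0.
suff : aw p.+1 f s - bd (aw p (fun r => f (x :: r))) s =
    aw p.+1 (f - bd (fun r => f (x :: r))) s +
    aw p (dy (fun r => f (x :: r))) s *~ (-1) ^+ p.+1 by [].
by rewrite (IHp (fun r => f (x :: r))) // awB exprS mulN1r mulrNz; zmod.
Qed.

Definition bicocycle p q f := [/\ bicochain p q f, bd f = 0 & dy f = 0].

(** Here [n] counts vertices. The last clause matters for [n = 0]: it forces [h = 0], so that the
    augmentation creates no coboundaries in degree 0. *)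
Definition reduced (n : nat) (h : seq G -> M) :=
  [/\ equivariant a setT h, supported n h & h [::] = 0].

Lemma reducedB n u v : reduced n u -> reduced n v -> reduced n (u - v).
Proof.
move=> [eh sh h0] [ek sk k0]; have E s : (u - v) s = u s - v s by [].
split; [exact: equivariantB|move=> s sn|by rewrite E h0 k0 subrr].
by rewrite E sh // sk // subrr.
Qed.

Lemma aw_reduced p q f : bicochain p q f -> reduced (p + q).+1 (aw p f).
Proof.
move=> [fs fe _]; split=> [g s _|s sn|]; last by case: p {fs}.
  suff H r (k k' : seq G -> seq G -> M) :
      (forall x y, k' [seq (g * z)%g | z <- x] [seq (g * z)%g | z <- y] = a g (k x y)) ->
      aw p k' [seq (g * z)%g | z <- r] = a g (aw p k r) by exact: H (fe g).
  elim: p r k k' {fs fe} => [|p IHp] [|x r] k k' kk' /=; rewrite ?raddf0 //.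
    by rewrite -(kk' [:: x]).
  by apply: (IHp r (fun r => k (x :: r))) => y z; rewrite -kk'.
elim: p s sn f fs {fe} => [|p IHp] [|x s] //= sn f fs; first by rewrite fs //= orbC sn.
by apply: IHp => // r y ry; apply: fs.
Qed.

Lemma reduced0 n : reduced n 0.
Proof. by split=> // g s _; rewrite raddf0. Qed.

Lemma reducedN n u : reduced n u -> reduced n (- u).
Proof. by move=> ru; rewrite -sub0r; apply: reducedB => //; exact: reduced0. Qed.

Lemma bicocycleN p q f : bicocycle p q f -> bicocycle p q (- f).
Proof.
move=> [cf df ddf]; rewrite -sub0r; split; first by apply: bicochainB => //; exact: bicochain0.
  by rewrite bd_funB df subr0; apply/funext => x; exact: bd0.
by rewrite dyB ddf subr0; apply/funext => x; apply/funext => y; exact: bd0.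
Qed.

Lemma bicocycle_dy p q g : bicochain p q g -> dy (bd g) = 0 -> bicocycle p q.+1 (dy g).
Proof. by move=> cg dg; split; [exact: bicochain_dy|rewrite bd_dy|exact: dy_dy]. Qed.

Lemma bicocycle_bd p q g : bicochain p q g -> dy (bd g) = 0 -> bicocycle p.+1 q (bd g).
Proof. by move=> cg dg; split; [exact: bicochain_bd|exact: bd_bd0|]. Qed.

(** One step of the zigzag: up to sign, [bd g] and [dy g] have cohomologous images under the
    Alexander-Whitney map. *)
Lemma aw_zigzag p q g : bicochain p q g ->
  aw p.+1 (bd g) = bd (aw p g) - (if odd p then - aw p (dy g) else aw p (dy g)).
Proof.
move=> [gs _ _]; rewrite aw_bd; last by move=> x; rewrite gs // orbT.
apply/funext => z; rewrite -signr_odd; have E (u v : seq G -> M) : (u - v) z = u z - v z by [].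
by rewrite E; case: odd; rewrite ?mulr1z ?mulrN1z ?addrK // -[RHS]addrA subrr addr0.
Qed.

Lemma bicocycle_lower p q f : bicocycle p.+1 q f -> exists f' h,
  [/\ bicocycle p q.+1 f', reduced (p + q).+1 h & aw p.+1 f - aw p f' = bd h].
Proof.
move=> [cf df dyf]; have [g cg dg] := bd_exact cf df.
have cdg : bicocycle p q.+1 (dy g) by apply: bicocycle_dy => //; rewrite dg.
exists (if odd p then dy g else - dy g), (aw p g); split.
- by case: odd => //; exact: bicocycleN.
- exact: aw_reduced.
rewrite -dg (aw_zigzag cg); case: odd; first by rewrite opprK addrK.
have -> : aw p (- dy g) = - aw p (dy g).
  apply/funext => z; rewrite -[- dy g]sub0r -{1}(subrr g) !awB.
  by rewrite subrr sub0r.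
by rewrite opprK subrK.
Qed.

Lemma bicocycle_to_uniform p q f : bicocycle p q f -> exists f' h,
  [/\ bicocycle 0 (p + q) f', reduced (p + q) h & aw p f - aw 0 f' = bd h].
Proof.
elim: p q f => [|p IHp] q f cf.
  by exists f, 0; split; [|exact: reduced0|rewrite subrr; apply/funext => s; rewrite bd0].
have [g [h [cg rh fg]]] := bicocycle_lower cf; have [f' [h' [cf' rh' gf']]] := IHp _ _ cg.
rewrite addnS in cf' rh'; exists f', (h + h'); split=> //.
  by rewrite -[h']opprK; apply: reducedB => //; exact: reducedN.
have -> : bd (h + h') = bd h + bd h' by apply/funext => s; exact: bdD.
by rewrite -fg -gf'; zmod.
Qed.

Definition is_uniform T (u : seq G -> T) := exists N : finNormal G, uniform N u.

(** Surjectivity: [c], taken constant in [y], is a bicocycle of bidegree [(n, 0)] whose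
    Alexander-Whitney image is [c]. The zigzag moves it to bidegree [(0, n)], where a bicocycle does
    not depend on [x] and is a uniform cocycle in [y]. *)
Lemma uniform_representative n c : equivariant a setT c -> bd c = 0 -> supported n.+1 c ->
  exists u h, [/\ [/\ equivariant a setT u, bd u = 0, supported n.+1 u & is_uniform u],
    reduced n h & c - u = bd h].
Proof.
move=> ec dc sc; pose f x (y : seq G) := if size y == 1%N then c x else 0.
have f1 y x : size y != 1%N -> f x y = 0 by rewrite /f => /negPf ->.
have cf : bicocycle n 0 f.
  split.
  - split=> [x y xy|g x y|].
    + by rewrite /f; case: (eqVneq (size y) 1%N) xy => //= _; rewrite orbF => /sc.
    + by rewrite /f size_map; case: ifP => _; [exact: ec|rewrite raddf0].
    have [_ _ [N _]] := @bicochain0 0 0.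
    by exists N => x s r sr; rewrite /f (same_cosets_size sr).
  - apply/funext => x; apply/funext => y; rewrite bd_eval /f.
    by case: eqP => _; [rewrite dc|rewrite bd0].
  apply/funext => x; apply/funext => y; have [y2|y2] := eqVneq (size y) 2; last first.
    by apply: (@bd_supported _ _ 1 _ _ _ y2) => s; exact: f1.
  by case: y y2 => [|y0 [|y1 []]] //= _; rewrite /dy /f /= subr0 subrr.
have [f' [h [[[fs fe [N fN]] df dyf] rh fh]]] := bicocycle_to_uniform cf.
rewrite addn0 in fs rh.
have f'E x y : f' [:: x] = f' [:: y].
  have := congr1 (fun k => k [:: y; x]) df; rewrite /= subr0 => /eqP.
  by rewrite subr_eq0 => /eqP.
exists (f' [:: 1%g]), h; split=> //.
  split=> [g s _|||].
  - by rewrite -fe /= (f'E 1%g (g * 1)%g).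
  - exact: (congr1 (fun k => k [:: 1%g]) dyf).
  - by move=> s sn; rewrite fs // sn orbT.
  - by exists N; exact: fN.
rewrite -fh; congr (_ - _).
  apply/funext => z; rewrite {fh cf ec dc}.
  suff H p (k : seq G -> M) s : aw p (fun x y => if size y == 1%N then k x else 0) s =
      if size s == p.+1 then k s else 0.
    by rewrite H; case: eqP => // /eqP /sc.
  elim: p s k => [|p IHp] [|x s] k //=; last exact: (IHp s (fun r => k (x :: r))).
  by case: s.
apply/funext => -[|x s] /=; last by rewrite (f'E _ x).
by rewrite fs // orbT.
Qed.

(** Induction on [q]. For [q = 0], [f] is constant in [y] and [h] itself gives the answer. Otherwise
    [f = dy g], and [bd g] is a bicocycle with smaller [q] whose image is again a coboundary. The
    induction hypothesis yields a correction of [g] that makes [bd g = 0]. For [p > 0] the corrected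
    [g] is some [bd m], and [dy m] is the required primitive; the induction uses this [bd] form. *)
Lemma uniform_primitive_step q : forall p f, bicocycle p q f ->
  (exists2 h, reduced (p + q) h & aw p f = bd h) ->
  if p is p'.+1 then exists k, [/\ bicochain p' q k, dy k = 0 & bd k = f]
  else if q is q'.+1 then exists k, [/\ bicochain 0 q' k, bd k = 0 & dy k = f]
  else f = 0.
Proof.
elim: q => [|q IHq] p f [cf df dyf] [h rh fh].
  have [fs fe _] := cf.
  have fE x y z : f x [:: y] = f x [:: z].
    have := congr1 (fun k => k x [:: z; y]) dyf; rewrite /dy /= subr0 => /eqP.
    by rewrite subr_eq0 => /eqP.
  have awE s z : size s = p.+1 -> aw p f s = f s [:: z].
    elim: p s f {cf df dyf fs fe fh rh} fE => [|p IHp] [|x s] // f fE [sp]; last first.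
      by apply: (IHp s (fun r => f (x :: r))) => // *; exact: fE.
    by case: s sp => //= _; exact: fE.
  rewrite addn0 in rh; have [eh sh h0] := rh.
  case: p => [|p] in f cf df dyf fh fs fe fE awE eh sh rh *.
    apply/funext => x; apply/funext => y.
    case: (eqVneq (size x) 1%N) => x1; last by rewrite fs // x1.
    case: (eqVneq (size y) 1%N) => y1; last by rewrite fs // y1 orbT.
    case: x y x1 y1 => [|x []] // [|y []] // _ _.
    by rewrite -awE // fh /= h0 subr0.
  pose k x (y : seq G) := if size y == 1%N then h x else 0; exists k; split.
  - split=> [x y xy|g x y|].
    + by rewrite /k; case: (eqVneq (size y) 1%N) xy => //= _; rewrite orbF => /sh.
    + by rewrite /k size_map; case: ifP => _; [exact: eh|rewrite raddf0].
    have [_ _ [N _]] := @bicochain0 0 0.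
    by exists N => x s r sr; rewrite /k (same_cosets_size sr).
  - apply/funext => x; apply/funext => y; have [y2|y2] := eqVneq (size y) 2; last first.
      by apply: (@bd_supported _ _ 1 _ _ _ y2) => s; rewrite /k => /negPf ->.
    by case: y y2 => [|y0 [|y1 []]] //= _; rewrite /dy /k /= subr0 subrr.
  apply/funext => x; apply/funext => y; rewrite bd_eval /k.
  case: (eqVneq (size y) 1%N) => y1; last by rewrite bd0 fs // y1 orbT.
  have [x2|x2] := eqVneq (size x) p.+2; last by rewrite fs ?x2 // (bd_supported sh).
  by case: y y1 => [|y []] // _; rewrite -awE // fh.
have [g cg dg] := dy_exact cf dyf.
have dbg : dy (bd g) = 0 by rewrite -bd_dy dg.
have [k [ck dk kg]] : exists k, [/\ bicochain p q k, dy k = 0 & bd k = bd g].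
  apply: (IHq p.+1 (bd g)); first exact: bicocycle_bd.
  exists (aw p g - (if odd p then - h else h)).
    apply: reducedB; first exact: aw_reduced.
    by rewrite addnS in rh; case: odd => //; exact: reducedN.
  rewrite (aw_zigzag cg) bd_funB dg fh; case: odd => //.
  by congr (_ - _); apply/funext => s; rewrite bdN.
have cgk : bicochain p q (g - k) by exact: bicochainB.
have dgk : bd (g - k) = 0 by rewrite bd_funB kg subrr.
have fgk : dy (g - k) = f by rewrite dyB dk subr0.
case: p => [|p] in f cf df dyf g dg k ck dk kg cg cgk dgk fgk rh fh dbg *; first by exists (g - k).
have [m cm dm] := bd_exact cgk dgk.
by exists (dy m); split; [exact: bicochain_dy|exact: dy_dy|rewrite bd_dy dm].
Qed.

(** Injectivity: [u], taken constant in [x], is a bicocycle of bidegree [(0, n)]. The primitive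
    found in the double complex satisfies [bd k = 0], hence is itself constant in [x]. *)
Lemma uniform_primitive n u : equivariant a setT u -> bd u = 0 -> supported n.+1 u ->
  is_uniform u -> (exists2 h, reduced n h & u = bd h) ->
  if n is m.+1 then exists h, [/\ reduced n h, is_uniform h & u = bd h] else u = 0.
Proof.
move=> eu du su [N uN] [h rh uh].
pose f (x : seq G) := if size x == 1%N then u else 0.
have cf : bicocycle 0 n f.
  split.
  - split=> [x y xy|g x y|].
    + by rewrite /f; case: (eqVneq (size x) 1%N) xy => // _ /su.
    + by rewrite /f size_map; case: ifP => _; [exact: eu|rewrite raddf0].
    by exists N => x; rewrite /f; case: ifP.
  - apply/funext => x; have [x2|x2] := eqVneq (size x) 2; last first.
      by apply: (@bd_supported _ _ 1 _ _ _ x2) => s; rewrite /f => /negPf ->.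
    by case: x x2 => [|x0 [|x1 []]] //= _; rewrite /f /= subr0 subrr.
  apply/funext => x; rewrite /dy /f; case: ifP => _; first exact: du.
  by apply/funext => s; rewrite bd0.
have := uniform_primitive_step cf; rewrite add0n => H.
have /H : exists2 h, reduced n h & aw 0 f = bd h.
  by exists h => //; rewrite -uh; apply/funext => -[|x s] //=; rewrite su.
case: n => [|n] in su rh f cf H *.
  by move=> /(congr1 (fun k => k [:: 1%g])).
move=> [k [[ks ke [K kK]] dk kf]].
have kE x y : k [:: x] = k [:: y].
  have := congr1 (fun k => k [:: y; x]) dk; rewrite /= subr0 => /eqP.
  by rewrite subr_eq0 => /eqP.
exists (k [:: 1%g]); split.
- split=> [g s _|s sn|]; last by rewrite ks // orbT.
    by rewrite -ke /= (kE 1%g (g * 1)%g).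
  by rewrite ks // sn orbT.
- by exists K; exact: kK.
by rewrite -[bd _]/(dy k [:: 1%g]) kf.
Qed.

End Bicochains.

(** * Continuous cochains of the profinite completion *)

Lemma bd_sum (T : Type) (B : zmodType) (f : seq T -> B) s :
  bd f s = \sum_(i < size s) f (take i s ++ drop i.+1 s) *~ (-1) ^+ i.
Proof.
elim: s f => [|x s IHs] f /=; first by rewrite big_ord0.
rewrite big_ord_recl /= mulr1z drop0 IHs -sumrN; congr (_ + _).
by apply: eq_bigr => i _; rewrite /= exprS mulN1r mulrNz.
Qed.

Section Tuples.
Variables (K : groupType) (M : zmodType) (n : nat).

Definition points (T : Type) (x : 'I_n.+1 -> T) : seq T := [seq x i | i <- enum 'I_n.+1].

Definition to_list (f : ('I_n.+1 -> K) -> M) (s : seq K) : M :=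
  if size s == n.+1 then f (fun i => nth 1%g s i) else 0.

Definition of_list (f : seq K -> M) (x : 'I_n.+1 -> K) : M := f (points x).

Lemma size_points (T : Type) (x : 'I_n.+1 -> T) : size (points x) = n.+1.
Proof. by rewrite size_map size_enum_ord. Qed.

Lemma nth_points (T : Type) z (x : 'I_n.+1 -> T) (i : 'I_n.+1) : nth z (points x) i = x i.
Proof. by rewrite (nth_map i) ?size_enum_ord // nth_ord_enum. Qed.

Lemma points_nth (s : seq K) : size s = n.+1 -> points (fun i : 'I_n.+1 => nth 1%g s i) = s.
Proof.
move=> sn; apply: (@eq_from_nth _ (1%g : K)); rewrite size_points // => i ni.
by rewrite -[i]/(nat_of_ord (Ordinal ni)) nth_points.
Qed.

Lemma to_listK f : of_list (to_list f) = f.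
Proof.
apply/funext => x; rewrite /of_list /to_list size_points eqxx; congr f.
by apply/funext => i; rewrite nth_points.
Qed.

Lemma of_listK f : supported n.+1 f -> to_list (of_list f) = f.
Proof.
move=> fn; apply/funext => s; rewrite /to_list; case: eqP => [sn|/eqP/fn //].
by rewrite /of_list points_nth.
Qed.

Lemma to_list_supported f : supported n.+1 (to_list f).
Proof. by move=> s; rewrite /to_list => /negPf ->. Qed.

Lemma points_map (T U : Type) (u : T -> U) (x : 'I_n.+1 -> T) :
  points (fun i => u (x i)) = map u (points x).
Proof. by rewrite /points -map_comp. Qed.

Lemma to_list_equivariant (a : action K M) f :
  (forall g x, f (fun i => (g * x i)%g) = a g (f x)) -> equivariant a setT (to_list f).
Proof.
move=> ef g s _; rewrite /to_list size_map; case: eqP => [sn|]; last by rewrite raddf0.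
by rewrite -ef; congr f; apply/funext => i; rewrite (nth_map 1%g) ?sn.
Qed.

End Tuples.

Lemma to_list_diff (K : topGroupType) (M : zmodType) n (f : cochain_fun K M n) :
  to_list (diff f) = bd (to_list f).
Proof.
apply/funext => s; have [sn|sn] := eqVneq (size s) n.+2; last first.
  by rewrite to_list_supported // (bd_supported (@to_list_supported _ _ _ _)).
rewrite {1}/to_list sn eqxx bd_sum /diff sn; apply: eq_bigr => i _.
have si : size (take i s ++ drop i.+1 s) = n.+1.
  by rewrite size_cat size_take size_drop sn ltn_ord; have := ltn_ord i; lia.
rewrite /to_list si eqxx; congr (_ *~ _); congr f; apply/funext => j.
rewrite nth_cat size_take sn ltn_ord /= /bump; case: ltnP => ji.
  by rewrite nth_take.
by rewrite nth_drop add1n; congr nth; lia.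
Qed.

Lemma of_list_diff (K : topGroupType) (M : zmodType) n (f : seq K -> M) :
  supported n.+1 f -> diff (of_list f : cochain_fun K M n) = of_list (bd f).
Proof. by move=> fn; rewrite -[LHS]to_listK to_list_diff of_listK. Qed.

Lemma discrete_cochain (G : groupType) (M : zmodType) (a : action G M) n
    (f : cochain_fun (discrete_topology G) M n) :
  (forall g x, f (fun i => (g * x i)%g) = a g (f x)) -> is_cochain (discrete_action a) f.
Proof.
move=> ef; split; last exact: ef.
apply/continuous_discrete => x.
have : \forall y \near x, forall i, y i = x i.
  apply: (@filter_forall _ _ (fun i (y : {ptws 'I_n.+1 -> discrete_topology G}) =>
    y i = x i) (nbhs x)) => i.
  have := @proj_continuous 'I_n.+1 (fun=> discrete_topology G) i x.
  by move=> /(_ [set x i] (@discrete_set1 (discrete_topology G) (x i))).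
by apply: filterS => y /funext ->.
Qed.

Section CompletionCochains.
Variables (G : groupType).
Local Notation Gh := (completion G).

Lemma completion_mem (x : Gh) (N : finNormal G) g : x N g -> x N = lcoset N g.
Proof.
have [h ->] := completion_coset x N; move=> [k Nk <-].
by apply/lcosetP; [exact: finNormal_subgroup|rewrite mulKg].
Qed.

Lemma completion_inh (x : Gh) (N : finNormal G) : exists g, x N g.
Proof.
have [h ->] := completion_coset x N; exists h, 1%g; last exact: mulg1.
by have [] := finNormal_subgroup N.
Qed.

Lemma completion_coarsen (x y : Gh) (K N : finNormal G) : K `<=` N -> x K = y K -> x N = y N.
Proof.
move=> KN xy; have [g xg] := completion_inh x K.
have yg : y K g by rewrite -xy.
by rewrite (completion_mem (completion_sub KN xg)) (completion_mem (completion_sub KN yg)).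
Qed.

Lemma completion_cvg (I : Type) (U : set_system I) (z : I -> Gh) (p : Gh) : Filter U ->
  (forall N, U [set i | z i N = p N]) -> z @ U --> p.
Proof.
move=> FU zp; move=> A [B [[C oC <-] /= Cx] sBA].
have zC : U [set i | C (z i : finNormal G -> set G)].
  suff : (fun i => completion_val (z i)) @ U --> (completion_val p :
      prod_topology (fun _ : finNormal G => discrete_topology (set G))).
    by apply; exact: open_nbhs_nbhs.
  apply/cvg_sup => N D [E [[H oH <-] /= Hx] sED].
  suff : U [set i | D (z i : finNormal G -> set G)] by [].
  apply: (@filterS _ _ _ _ _ _ (zp N)) => i /= e.
  by apply: sED; rewrite /= e.
by apply: filterS zC => i; exact: sBA.
Qed.

Lemma ptws_cvg (I J : Type) (T : topologicalType) (U : set_system I)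
    (z : I -> {ptws J -> T}) (p : {ptws J -> T}) : Filter U ->
  (forall j, (fun i => z i j) @ U --> p j) -> z @ U --> p.
Proof.
move=> FU zp; apply/cvg_sup => j A [B [[C oC <-] /= Cx] sBA].
have UC : U [set i | C (z i j)] := zp j C (open_nbhs_nbhs (conj oC Cx)).
suff : U [set i | A (z i)] by [].
by apply: filterS UC => i; exact: sBA.
Qed.

Definition finNormal_filter : set_system (finNormal G) :=
  filter_from setT (fun N0 : finNormal G => [set N : finNormal G | N `<=` N0]).

Lemma finNormal_inh : exists N : finNormal G, True.
Proof. by have [//|//|N _] := @finite_action_kernel G unit (fun=> id); exists N. Qed.

Lemma finNormal_filter_proper : ProperFilter finNormal_filter.
Proof.
apply: filter_from_proper; last by move=> N _; exists N.
apply: filter_from_filter; first by have [N _] := finNormal_inh; exists N.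
move=> N N' _ _; have [K KE] := finNormalI N N'; exists K => //.
by move=> L /= LK; split=> x /LK; rewrite KE => -[].
Qed.

(* This is the compactness of the profinite completion.                       *)
Lemma completion_ultra_lim (I : Type) (U : set_system I) (z : I -> Gh) : UltraFilter U ->
  exists p : Gh, forall N, U [set i | z i N = p N].
Proof.
move=> UU; have lim N : exists A, U [set i | z i N = A] /\ exists g, A = lcoset N g.
  have [m [cl [rep [clP repK repP]]]] := coset_index N.
  have [b Ub] := ultra_const UU (fun i => cl (xget 1%g (z i N))).
  exists (lcoset N (rep b)); split; last by exists (rep b).
  apply: filterS Ub => i /= <-; rewrite repP.
  have [g] := completion_inh (z i) N.
  by move=> /(xgetI 1%g) /completion_mem.
have [A AP] := boolp.choice lim.
have cA : compatible A.
  split=> [N|N N' NN']; first by have [_] := AP N.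
  have [UA _] := AP N; have [UA' _] := AP N'.
  by have [i [/= <- <-]] := ultra_ex2 UU UA UA'; exact: completion_sub.
by exists (Completion cA) => N; have [] := AP N.
Qed.

(** Otherwise each [N] has a pair of points that agree modulo [N] but are separated by [f]. Along an
    ultrafilter of shrinking [N] both points tend to the same limit, near which [f] is constant. *)
Lemma continuous_uniform n (M : choiceType) (f : {ptws 'I_n.+1 -> Gh} -> discrete_topology M) :
  continuous f -> exists N : finNormal G,
    forall x y : 'I_n.+1 -> Gh, (forall i, x i N = y i N) -> f x = f y.
Proof.
move=> /continuous_discrete cf; apply: contrapT => /forallNP nf.
have bad (N : finNormal G) : exists xy : {ptws 'I_n.+1 -> Gh} * {ptws 'I_n.+1 -> Gh},
    (forall i, xy.1 i N = xy.2 i N) /\ f xy.1 <> f xy.2.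
  have /existsNP[x /existsNP[y /not_implyP[xy fxy]]] := nf N.
  by exists (x, y).
have [xy xyP] := boolp.choice bad.
have [U [UU sU]] := ultraFilterLemma finNormal_filter_proper.
have /boolp.choice[p pP] (i : 'I_n.+1) :
    exists p : Gh, forall N, U [set K | (xy K).1 i N = p N] by exact: completion_ultra_lim.
have lim (z : finNormal G -> {ptws 'I_n.+1 -> Gh}) :
    (forall i N, U [set K | z K i N = p i N]) -> U [set K | f (z K) = f p].
  move=> zp; have /(_ _ (cf p)) : z @ U --> (p : {ptws 'I_n.+1 -> Gh}).
    by apply: ptws_cvg => i; exact: completion_cvg.
  by [].
have U1 := lim (fun K => (xy K).1) pP.
have U2 : U [set K | f (xy K).2 = f p].
  apply: lim => i N; have : U [set K : finNormal G | K `<=` N] by apply: sU; exists N.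
  move=> UN; apply: filterS2 (pP i N) UN => K /= e KN; rewrite -e.
  by have [/(_ i) eK _] := xyP K; exact/esym/(completion_coarsen KN eK).
have [K [/= e1 e2]] := ultra_ex2 UU U1 U2.
by have [_] := xyP K; apply; rewrite e1 e2.
Qed.

End CompletionCochains.

Section Comparison.
Variables (G : groupType) (M : finZmodType) (a : action G M) (n : nat).
Local Notation Gh := (completion G).
Local Notation ah := (completion_action a).
Local Notation ad := (discrete_action a).

(** Density of [G] in its completion: two uniform functions are compared at points of [G] that agree
    with [x] modulo a common subgroup. *)
Lemma pullback_inj (f h : cochain_fun Gh M n) : is_cochain ah f -> is_cochain ah h ->
  pullback_fun (@to_completion G) f = pullback_fun (@to_completion G) h -> f = h.
Proof.
move=> [cf _] [ch _] fh; have [N fN] := continuous_uniform cf.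
have [N' hN'] := continuous_uniform ch; have [K KE] := finNormalI N N'.
have [KN KN'] : K `<=` N /\ K `<=` N' by rewrite KE; split=> z [].
apply/funext => x.
have /boolp.choice[g gP] (i : 'I_n.+1) : exists g, x i K g by exact: completion_inh.
have xg (L : finNormal G) i : K `<=` L -> x i L = to_completion (g i) L.
  by move=> KL; rewrite (completion_mem (completion_sub KL (gP i))).
rewrite (fN _ (fun i => to_completion (g i))) => [|i]; last exact: xg.
rewrite (hN' _ (fun i => to_completion (g i))) => [|i]; last exact: xg.
exact: (congr1 (@^~ g) fh).
Qed.

Lemma pullback_uniform (f : cochain_fun Gh M n) : is_cochain ah f ->
  @is_uniform G M (to_list (pullback_fun (@to_completion G) f)).
Proof.
move=> [cf _]; have [N fN] := continuous_uniform cf; exists N => s r sr.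
rewrite /to_list (same_cosets_size sr); case: eqP => // rn.
apply: fN => i /=; have := congr1 (fun l => nth set0 l i) sr.
by rewrite !(nth_map 1%g) ?(same_cosets_size sr) ?rn.
Qed.

Lemma uniform_extension (u : seq G -> M) : equivariant a setT u -> is_uniform u ->
  exists2 f : cochain_fun Gh M n, is_cochain ah f &
    pullback_fun (@to_completion G) f = of_list u.
Proof.
(* Intersecting with the kernel of the action makes a point of the completion act through its
   representative modulo [K]. *)
move=> eu [N uN]; have [K KE] := finNormalI N (action_ker a).
have [KN Ka] : K `<=` N /\ K `<=` action_ker a by rewrite KE; split=> z [].
have uK : uniform K u.
  by move=> s r sr; apply: uN; apply: same_cosets_sub sr => //; exact: finNormal_subgroup.
pose rep (x : Gh) := xget 1%g (x K).
have repP (x : Gh) : x K (rep x) by have [g /(xgetI 1%g)] := completion_inh x K.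
have repE (x : Gh) g : x K g -> lcoset K (rep x) = lcoset K g.
  by move=> /completion_mem <-; rewrite -(completion_mem (repP x)).
exists (fun x => u (points (fun i => rep (x i)))).
  split.
    apply/continuous_discrete => x.
    have : nbhs (x : {ptws 'I_n.+1 -> Gh})
      [set y : {ptws 'I_n.+1 -> Gh} | forall i, (y i : Gh) K = (x i : Gh) K].
      apply: (@filter_forall _ _ (fun i (y : {ptws 'I_n.+1 -> Gh}) =>
        (y i : Gh) K = (x i : Gh) K) (nbhs x)) => i.
      exact: (@proj_continuous 'I_n.+1 (fun=> Gh) i x _ (completion_near (x i) K)).
    apply: filterS => y yx; congr u; congr points; apply/funext => i.
    by rewrite /rep yx.
  move=> g x; rewrite -[RHS]/(completion_act a g _) (completion_actE (g := rep g)); last first.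
    exact: (completion_sub Ka (repP g)).
  rewrite -eu // -points_map; apply: uK; rewrite /same_cosets -!points_map.
  congr points; apply/funext => i; apply: repE.
  by exists (rep g) => //; exists (rep (x i)).
apply/funext => x; apply: uK; rewrite /same_cosets -!points_map.
congr points; apply/funext => i; apply: repE.
by exists 1%g; [have [] := finNormal_subgroup K|rewrite mulg1].
Qed.

End Comparison.

(** * Serre's criterion and the theorem *)

Section CohomologyClass.
Local Open Scope quotient_scope.

Lemma cohomology_pi_eq (K : topGroupType) (M : zmodType) (a : action K M) n (z w : cocycle a n) :
  \pi_(cohomology a n) z = \pi_(cohomology a n) w <->
  is_coboundary a (cocycle_val z - cocycle_val w : cochain_fun K M n).
Proof.
split=> [/eqP|zw]; first by rewrite -Quotient.idealrBE => /asboolP.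
by apply/eqP; rewrite -Quotient.idealrBE; apply/asboolP.
Qed.

End CohomologyClass.

(** Both halves produce a uniform cochain on [G], extend it continuously to the completion, and
    carry the identities that it satisfies back along [pullback_inj]. *)
Lemma effaceable_good (G : groupType) : effaceable G -> good G.
Proof.
move=> effG p _ n M a _.
have cmp_pi := cohomology_map_pi (@to_completionM G) (@to_completion_continuous G)
  (completion_action_to a).
pose pull m (f : cochain_fun (completion G) M m) := pullback_fun (@to_completion G) f.
have pull_cochain m f : is_cochain (completion_action a) f ->
    is_cochain (discrete_action a) (pull m f).
  move=> cf; apply: (pullback_cochain (@to_completionM G)) cf.
    exact: to_completion_continuous.
  exact: completion_action_to.
have lst_cochain m (f : cochain_fun (discrete_topology G) M m) : is_cochain (discrete_action a) f ->
    equivariant a setT (to_list f).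
  by move=> [_ ef]; apply: to_list_equivariant.
have lst_cocycle m (f : cochain_fun (discrete_topology G) M m) : is_cocycle (discrete_action a) f ->
    bd (to_list f) = 0.
  move=> [_ df]; rewrite -to_list_diff df; apply/funext => s.
  by rewrite /to_list; case: ifP.
suff [inj surj] : injective (@comparison G M a n) /\ forall c, exists d, @comparison G M a n d = c.
  have [g gP] := boolp.choice surj; exists g => // d; apply: inj; exact: gP.
split.
  move=> d d'; rewrite -[d]reprK -[d']reprK /comparison !cmp_pi.
  move: (repr d) (repr d') => z w {d d'} /cohomology_pi_eq zw; apply/cohomology_pi_eq.
  have /asboolP[cz dz] := cocycleP z; have /asboolP[cw dw] := cocycleP w.
  pose f : cochain_fun (completion G) M n := cocycle_val z - cocycle_val w.
  have cf : is_cochain (completion_action a) f by exact: is_cochainB.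
  have df : diff f = 0 by rewrite /f diffB dz dw subrr.
  have {}zw : is_coboundary (discrete_action a) (pull n f) by [].
  suff : is_coboundary (completion_action a) f by [].
  clearbody f; clear z w cz dz cw dw; case: n f cf df zw => [|m] f cf df.
    by move=> zw; apply: (@pullback_inj _ _ a) => //; exact: is_cochain0.
  move=> [h ch fh].
  have uf := pullback_uniform cf; have pf := pull_cochain _ _ cf.
  have := uniform_primitive effG (lst_cochain _ _ pf) _ (@to_list_supported _ _ _ _) uf.
  case=> [||h' [[eh' sh' h'0] uh' fh']].
  - by apply: lst_cocycle; split=> //; rewrite /pull pullback_diff df.
  - exists (to_list h); last first.
      exact: (etrans (congr1 (@to_list _ _ _) fh) (to_list_diff h)).
    by split; [exact: lst_cochain|exact: to_list_supported|rewrite to_list_supported].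
  have [g cg gh'] := uniform_extension m eh' uh'.
  exists g => //; apply: (@pullback_inj _ _ a) => //; first exact: is_cochain_diff.
  by rewrite -pullback_diff gh' of_list_diff // -fh' to_listK.
move=> c; rewrite -[c]reprK; move: (repr c) => z {c}.
have /asboolP[cz dz] := cocycleP z.
have [u [h [[eu du su uu] [eh sh h0] zh]]] := uniform_representative effG
  (lst_cochain _ _ cz) (lst_cocycle _ _ (conj cz dz)) (@to_list_supported _ _ _ _).
have [f cf fu] := uniform_extension n eu uu.
have df : diff f = 0.
  apply: (@pullback_inj _ _ a); [exact: is_cochain_diff|exact: is_cochain0|].
  by rewrite -pullback_diff fu of_list_diff // du.
have fP : f \in @cocycle_pred _ _ (completion_action a) n by apply/asboolP.
exists (\pi_(cohomology (completion_action a) n)%qT (Cocycle fP)).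
rewrite /comparison cmp_pi; apply/esym/cohomology_pi_eq.
have -> : cocycle_val z - cocycle_val (pullback (@to_completionM G) (@to_completion_continuous G)
    (completion_action_to a) (Cocycle fP)) = of_list (bd h) :> cochain_fun _ M n.
  by rewrite -zh /= fu -[cocycle_val z in LHS]to_listK.
case: n sh {z cz dz u eu du su uu zh f cf fu df fP} => [|m] sh.
  (* In degree 0 a coboundary must be zero: [h] lives on the empty sequence only, where it vanishes
     because it is reduced. *)
  apply/funext => x; have -> : h = 0.
    by apply/funext => s; have [|/sh //] := eqVneq (size s) 0; case: s.
  exact: bd0.
exists (of_list h); last by rewrite of_list_diff.
apply: discrete_cochain => g x; rewrite /of_list points_map; exact: eh.
Qed.

Theorem proposition5p2 (G : groupType) (hfg : finitely_generated G)
    (hfbc : free_by_cyclic G) : good G.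
Proof. by apply: effaceable_good; exact: free_by_cyclic_effaceable. Qed.
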